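(* Let $\beta$ be a braid with closure $\mathcal{L}_\beta\subset S^3$, let $w_\beta$ be its writhe, and let $\langle\widehat\beta\rangle_\circ$ be the associated linear combination of collections of labeled essential circles in the annulus (see context). Then: (1) for every $n\ge 1$, $P_n(\mathcal{L}_\beta)$ is equal to $q^{n w_\beta}$ times the element of $\mathbb{Z}[q,q^{-1}]$ obtained from $\langle\widehat\beta\rangle_\circ$ by assigning to each $k$-labeled circle the value ${n\brack k}$ (multiplicatively over the circles of a collection); (2) $P_\infty(\mathcal{L}_\beta)$ is equal to $a^{w_\beta}$ times the element obtained from $\langle\widehat\beta\rangle_\circ$ by assigning to each $k$-labeled circle the value $$q^{k^2}a^{-k}\prod_{i=1}^k\frac{1-a^2q^{2-2i}}{1-q^{2i}} .$$
   Context: $[k]=\frac{q^k-q^{-k}}{q-q^{-1}}$ are quantum integers and ${k\brack l}$ are quantum binomial coefficients. Webs. A (braid-like) web is an upward-directed planar trivalent graph in a strip, with edges labeled by positive integers, built from merges $(k,l)\to k+l$ and splits $k+l\to(k,l)$. Its annular closure is a web in the annulus. Webs are taken up to isotopy and modulo the $\mathbb{Z}[q,q^{-1}]$-linear local relations (and those obtained from these by symmetry or by reversing all orientations): (i) associativity: the two ways of merging $(k,l,p)$ to $k+l+p$ are equal; (ii) digon removal: $k{+}l\to(k,l)\to k{+}l$ equals ${k+l\brack l}$ times the identity strand; (iii) square relation: on strands $(k,l)$, the web moving a $1$-labeled edge from the left strand to the right strand and then a $1$-labeled edge back, minus the web moving a $1$-labeled edge from the right strand to the left and then one back, equals $[k-l]$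 times the identity. Bracket. For a braid $\beta$ (strands directed upward, labeled $1$), $\langle\beta\rangle$ is obtained by replacing each positive crossing (over-strand going from bottom left to top right) by $q^{-1}\mathrm{Id}-E$ and each negative crossing by $-E+q\,\mathrm{Id}$, where $\mathrm{Id}$ is two parallel strands and $E$ is the web $(1,1)\to 2\to(1,1)$. The writhe $w_\beta$ is the number of positive minus the number of negative crossings. $\langle\widehat\beta\rangle$ is the annular closure. Using only relations (i)–(iii) (and their symmetric versions) the annular closure of every braid-like web can be written as a $\mathbb{Z}[q,q^{-1}]$-linear combination of collections of concentric essential circles labeled by positive integers; the resulting expression of $\langle\widehat\beta\rangle$ is denoted $\langle\widehat\beta\rangle_\circ$, and it is unique once the labels are required to be radially non-decreasing. Link polynomials. $P_n$ is the (uncolored, framing-independent) $\mathfrak{sl}_n$ Reshetikhin–Turaev polynomial: $P_n(\mathcal{L})=q^{nw}$ times the evaluation, by the Cautis–Kamnitzer–Morrison $\mathfrak{sl}_n$ web relations, of the linear combination of webs obtained from a diagram of writhe $w$ by replacing each positive crossing by $q^{-1}\mathrm{Id}-E$ and each negative crossing by $-E+q\,\mathrm{Id}$; equivalently it satisfies $q^{-n}P_n(L_+)-q^{n}P_n(L_-)=(q^{-1}-q)P_n(L_0)$ and takes the value $[n]$ on the unknot. $P_\infty$ is the HOMFLYPT polynomial, the unique link invariant with $a^{-1}P_\infty(L_+)-aP_\infty(L_-)=(q^{-1}-q)P_\infty(L_0)$ and value $\frac{a-a^{-1}}{q-q^{-1}}$ on the unknot. Here $L_\pm$ have a positive/negative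 crossing and $L_0$ its oriented resolution. *)

(* Defs.v *)
From HB Require Import structures.
From mathcomp Require Import all_boot all_order all_algebra.
From mathcomp Require Import fraction finmap monalg.

Set Implicit Arguments.
Unset Strict Implicit.
Unset Printing Implicit Defensive.

Import GRing.Theory.
Local Open Scope ring_scope.

(* Z[q, q^-1] is the subring [laurent] of Q(q) = Frac Z[q].  *)
Definition Qq : fieldType := {fraction {poly int}}.
Definition q : Qq := FracField.tofrac ('X : {poly int}).

Definition laurent (x : Qq) : Prop :=
  exists (p : {poly int}) (n : nat), x = FracField.tofrac p / q ^+ n.

Definition qint (z : int) : Qq := (q ^ z - q ^ (- z)) / (q - q^-1).

(* [n][n-1]...[n-k+1] / [k]!, which is 0 for k > n.  *)
Definition qbinom (n k : nat) : Qq :=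
  \prod_(i < k) (qint (n%:Z - i%:Z) / qint i.+1%:Z).

Definition Qqa : fieldType := {fraction {poly Qq}}.
Definition inQqa (x : Qq) : Qqa := FracField.tofrac (x%:P).
Definition a : Qqa := FracField.tofrac ('X : {poly Qq}).

(* Planar diagrams in a strip, read from bottom to top as a stack of slices.  *)
(* A slice (L, g, R) is the elementary piece g with vertical strands labeled  *)
(* by L on its left and by R on its right.                                    *)
Definition diagram (A G : Type) : Type := seq (seq A * G * seq A).

Fixpoint typed (A : eqType) (G : Type) (src tgt : G -> seq A)
    (s : seq A) (D : diagram A G) (t : seq A) : bool :=
  match D with
  | [::] => s == t
  | (L, g, R) :: D' =>
      (s == L ++ src g ++ R) && typed src tgt (L ++ tgt g ++ R) D' t
  end.

Definition whisker (A G : Type) (L : seq A) (D : diagram A G) (R : seq A) :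
    diagram A G :=
  [seq (L ++ x.1.1, x.1.2, x.2 ++ R) | x <- D].

(* Two diagrams s -> t differing in the heights of two distant pieces.  *)
Variant exchange (A G : Type) (src tgt : G -> seq A) :
    seq A -> seq A -> diagram A G -> diagram A G -> Prop :=
| Exchange g M h :
    exchange src tgt (src g ++ M ++ src h) (tgt g ++ M ++ tgt h)
      [:: ([::], g, M ++ src h); (tgt g ++ M, h, [::])]
      [:: (src g ++ M, h, [::]); ([::], g, M ++ tgt h)].

Variant vertex := Merge of nat & nat | Split of nat & nat.

Definition vertex_code (v : vertex) : bool * nat * nat :=
  match v with Merge k l => (true, k, l) | Split k l => (false, k, l) end.
Definition vertex_decode (c : bool * nat * nat) : vertex :=
  let: (b, k, l) := c in if b then Merge k l else Split k l.
Lemma vertex_codeK : cancel vertex_code vertex_decode.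
Proof. by case. Qed.
HB.instance Definition _ := Countable.copy vertex (can_type vertex_codeK).

Definition vsrc (v : vertex) : seq nat :=
  match v with Merge k l => [:: k; l] | Split k l => [:: (k + l)%N] end.
Definition vtgt (v : vertex) : seq nat :=
  match v with Merge k l => [:: (k + l)%N] | Split k l => [:: k; l] end.
Definition vpos (v : vertex) : bool :=
  match v with Merge k l | Split k l => (0 < k)%N && (0 < l)%N end.

Definition is_web (s : seq nat) (W : diagram nat vertex) (t : seq nat) : bool :=
  [&& typed vsrc vtgt s W t, all (leq 1) s & all (fun x => vpos x.1.2) W].

(* Edges labeled 0 are erased: a vertex with a 0-labeled leg is just a        *)
(* vertical strand.                                                           *)
Definition erase0 (W : diagram nat vertex) : diagram nat vertex :=
  [seq (filter (leq 1) x.1.1, x.1.2, filter (leq 1) x.2)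
     | x <- W & vpos x.1.2].

(* A 1-labeled edge moved to the right, (k+1, l) -> (k, l+1), resp. to the    *)
(* left, (k, l+1) -> (k+1, l).                                                *)
Definition shift_right (k l : nat) : diagram nat vertex :=
  [:: ([::], Split k 1, [:: l]); ([:: k], Merge 1 l, [::])].
Definition shift_left (k l : nat) : diagram nat vertex :=
  [:: ([:: k], Split 1 l, [::]); ([::], Merge k 1, [:: l])].

(* [web_relation s t r]: the formal linear combination r of webs s -> t is    *)
(* set to 0.  The left-right mirror image of the square relation is the       *)
(* square relation itself, since [l - k] = - [k - l].                         *)
Variant web_relation :
    seq nat -> seq nat -> seq (Qq * diagram nat vertex) -> Prop :=
| rel_isotopy s t W1 W2 of exchange vsrc vtgt s t W1 W2 :
    web_relation s t [:: (1, W1); (-1, W2)]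
| rel_merge k l p :
    web_relation [:: k; l; p] [:: (k + l + p)%N]
      [:: (1, [:: ([::], Merge k l, [:: p]); ([::], Merge (k + l) p, [::])]);
          (-1, [:: ([:: k], Merge l p, [::]); ([::], Merge k (l + p), [::])])]
| rel_split k l p :
    web_relation [:: (k + l + p)%N] [:: k; l; p]
      [:: (1, [:: ([::], Split (k + l) p, [::]); ([::], Split k l, [:: p])]);
          (-1, [:: ([::], Split k (l + p), [::]); ([:: k], Split l p, [::])])]
| rel_digon k l :
    web_relation [:: (k + l)%N] [:: (k + l)%N]
      [:: (1, [:: ([::], Split k l, [::]); ([::], Merge k l, [::])]);
          (- qbinom (k + l) l, [::])]
| rel_square k l :
    web_relation [:: k.+1; l.+1] [:: k.+1; l.+1]
      [:: (1, erase0 (shift_right k l.+1 ++ shift_left k l.+1));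
          (-1, erase0 (shift_left k.+1 l ++ shift_right k.+1 l));
          (- qint (k.+1%:Z - l.+1%:Z), [::])].

(* The annular closure of a web W : s -> s is represented by (s, W).  *)
Definition annular_web : Type := seq nat * diagram nat vertex.
HB.instance Definition _ := Choice.on annular_web.

(* The Z[q, q^-1]-submodule spanned by the relations between annular          *)
(* closures: [null_rotate] is the isotopy rotating the annulus.               *)
Inductive annular_null : {malg Qq[annular_web]} -> Prop :=
| null_zero : annular_null 0
| null_lin c x y : laurent c -> annular_null x -> annular_null y ->
    annular_null (c *: x + y)
| null_rotate s t U V : is_web s U t -> is_web t V s ->
    annular_null (<< (s, U ++ V) : annular_web >> - << (t, V ++ U) >>)
| null_local b s t r U V L R : web_relation s t r ->
    is_web b U (L ++ s ++ R) -> is_web (L ++ t ++ R) V b ->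
    (forall x, x \in r -> is_web s x.2 t) ->
    annular_null
      (\sum_(x <- r) << x.1 *g ((b, U ++ whisker L x.2 R ++ V) : annular_web) >>).

(* Braid words on m strands, read from bottom to top: (true, i) is the        *)
(* positive crossing of the strands at positions i and i+1 (counted from 0),  *)
(* (false, i) the negative one.                                               *)
Definition braid (m : nat) : Type := seq (bool * 'I_m.-1).

Definition writhe (m : nat) (beta : braid m) : int :=
  \sum_(x <- beta) (if x.1 then 1 else -1).

Definition dumbbell (m : nat) (i : 'I_m.-1) : diagram nat vertex :=
  whisker (nseq i 1%N) [:: ([::], Merge 1 1, [::]); ([::], Split 1 1, [::])]
    (nseq (m - i.+2) 1%N).

Fixpoint bracket (m : nat) (beta : braid m) :
    seq (Qq * diagram nat vertex) :=
  match beta with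
  | [::] => [:: (1, [::])]
  | (b, i) :: beta' =>
      [seq ((if b then q^-1 else q) * x.1, x.2) | x <- bracket beta']
      ++ [seq (- x.1, dumbbell i ++ x.2) | x <- bracket beta']
  end.

Definition annular_bracket (m : nat) (beta : braid m) :
    {malg Qq[annular_web]} :=
  \sum_(x <- bracket beta) << x.1 *g ((nseq m 1%N, x.2) : annular_web) >>.

(* A collection of concentric essential circles is the sequence of its        *)
(* labels in radial order, i.e. the closure of an identity web.               *)
Definition circles_annular (c : {malg Qq[seq nat]}) :
    {malg Qq[annular_web]} :=
  \sum_(s <- msupp c) << c@_s *g ((s, [::]) : annular_web) >>.

(* c is an expression of the closed bracket as a Z[q, q^-1]-linear            *)
(* combination of collections of circles.  No radial order of the labels is   *)
(* imposed, so the radially non-decreasing expression is a special case.      *)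
Definition circle_expression (m : nat) (beta : braid m)
    (c : {malg Qq[seq nat]}) : Prop :=
  [/\ forall s, laurent c@_s,
      forall s, s \in msupp c -> all (leq 1) s
    & annular_null (annular_bracket beta - circles_annular c)].

Definition circle_eval (K : fieldType) (f : Qq -> K) (v : nat -> K)
    (c : {malg Qq[seq nat]}) : K :=
  \sum_(s <- msupp c) f c@_s * \prod_(k <- s) v k.

Definition circle_infty (k : nat) : Qqa :=
  inQqa q ^+ (k ^ 2)%N * a ^- k *
  \prod_(1 <= i < k.+1)
     ((1 - a ^+ 2 * inQqa q ^ (2%:Z - (2 * i)%N%:Z))
        / (1 - inQqa q ^+ (2 * i)%N)).

(* Oriented strands: true is upward, false is downward.  In Cross o x y the   *)
(* incoming strands are oriented by x (left) and y (right), and o says        *)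
(* whether the strand from bottom left to top right is the over-strand.       *)
Variant tangle_piece :=
  | Cup of bool
  | Cap of bool
  | Cross of bool & bool & bool.

Definition tsrc (g : tangle_piece) : seq bool :=
  match g with
  | Cup _ => [::] | Cap x => [:: x; ~~ x] | Cross _ x y => [:: x; y]
  end.
Definition ttgt (g : tangle_piece) : seq bool :=
  match g with
  | Cup x => [:: x; ~~ x] | Cap _ => [::] | Cross _ x y => [:: y; x]
  end.

Definition tangle : Type := diagram bool tangle_piece.
Definition is_link (D : tangle) : bool := typed tsrc ttgt [::] D [::].

(* Planar isotopies of sliced diagrams and Reidemeister moves.  *)
Variant tangle_move : seq bool -> seq bool -> tangle -> tangle -> Prop :=
| move_exchange s t D1 D2 of exchange tsrc ttgt s t D1 D2 :
    tangle_move s t D1 D2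
| move_zigzag_l x :
    tangle_move [:: x] [:: x]
      [:: ([::], Cup x, [:: x]); ([:: x], Cap (~~ x), [::])] [::]
| move_zigzag_r x :
    tangle_move [:: x] [:: x]
      [:: ([:: x], Cup (~~ x), [::]); ([::], Cap x, [:: x])] [::]
| move_cup o x y :
    tangle_move [:: y] [:: x; y; ~~ x]
      [:: ([:: y], Cup x, [::]); ([::], Cross o y x, [:: ~~ x])]
      [:: ([::], Cup x, [:: y]); ([:: x], Cross (~~ o) (~~ x) y, [::])]
| move_cap o x y :
    tangle_move [:: x; y; ~~ x] [:: y]
      [:: ([::], Cross o x y, [:: ~~ x]); ([:: y], Cap x, [::])]
      [:: ([:: x], Cross (~~ o) y (~~ x), [::]); ([::], Cap x, [:: y])]
| move_R1 o x :
    tangle_move [:: x] [:: x]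
      [:: ([:: x], Cup x, [::]); ([::], Cross o x x, [:: ~~ x]);
          ([:: x], Cap x, [::])]
      [::]
| move_R2 o x y :
    tangle_move [:: x; y] [:: x; y]
      [:: ([::], Cross o x y, [::]); ([::], Cross (~~ o) y x, [::])] [::]
(* The excluded crossings are those where no strand lies above the other two. *)
| move_R3 o1 o2 o3 x y z of ~~ ((o1 == o3) && (o2 != o1)) :
    tangle_move [:: x; y; z] [:: z; y; x]
      [:: ([::], Cross o1 x y, [:: z]); ([:: y], Cross o2 x z, [::]);
          ([::], Cross o3 y z, [:: x])]
      [:: ([:: x], Cross o3 y z, [::]); ([::], Cross o2 x z, [:: y]);
          ([:: z], Cross o1 x y, [::])].

Definition link_invariant (K : Type) (P : tangle -> K) : Prop :=
  forall s t D1 D2 U V L R, tangle_move s t D1 D2 ->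
    typed tsrc ttgt [::] U (L ++ s ++ R) ->
    typed tsrc ttgt (L ++ t ++ R) V [::] ->
    P (U ++ whisker L D1 R ++ V) = P (U ++ whisker L D2 R ++ V).

(* Every skein triple of links is isotopic to one whose distinguished         *)
(* crossing points upward.                                                    *)
Definition skein_relation (K : fieldType) (l z : K) (P : tangle -> K) : Prop :=
  forall U V L R,
    is_link (U ++ [:: (L, Cross true true true, R)] ++ V) ->
    l^-1 * P (U ++ [:: (L, Cross true true true, R)] ++ V)
      - l * P (U ++ [:: (L, Cross false true true, R)] ++ V)
    = z * P (U ++ V).

Definition unknot : tangle := [:: ([::], Cup true, [::]); ([::], Cap true, [::])].

Definition is_sln_polynomial (n : nat) (P : tangle -> Qq) : Prop :=
  [/\ link_invariant P, skein_relation (q ^+ n) (q^-1 - q) P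
    & P unknot = qint n%:Z].

Definition is_HOMFLYPT (P : tangle -> Qqa) : Prop :=
  [/\ link_invariant P, skein_relation a (inQqa q^-1 - inQqa q) P
    & P unknot = (a - a^-1) / (inQqa q - inQqa q^-1)].

(* The braid is closed by m nested arcs to its right.  *)
Definition braid_closure (m : nat) (beta : braid m) : tangle :=
  [seq (nseq i true, Cup true, nseq i false) | i <- iota 0 m]
  ++ [seq (nseq (x.2 : 'I_m.-1) true, Cross x.1 true true,
           nseq (m - (x.2 : nat).+2) true ++ nseq m false) | x <- beta]
  ++ [seq (nseq i true, Cap true, nseq i false) | i <- rev (iota 0 m)].

(* Main.v *)
From HB Require Import structures.
From mathcomp Require Import all_boot all_order all_algebra.
From mathcomp Require Import fraction finmap monalg.
From mathcomp Require Import boolp functions.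
From mathcomp Require Import ring zify.
Require Import Defs.

(** Any skein invariant P of links restricts to a Markov trace on braids: with
    lam = q^n or lam = a, the function u |-> lam^(- writhe u) P (closure of u)
    satisfies the quadratic relation of the Hecke algebra, is central, and is
    multiplied by fixed scalars when a strand is added, with or without a
    crossing. In terms of the elements E for which an upward crossing is q^-1 - E or
    q - E, it is a trace on Hecke algebras.

    Webs can be evaluated by this trace alone. An edge of label k is replaced by k
    parallel strands carrying the antisymmetrizing idempotent P_k of the Hecke
    algebra, a merge k, l -> k+l by P_(k+l), and a split by the same idempotent
    times a q-binomial. Associativity and the digon relation follow from the
    absorption of small antisymmetrizers by large ones ([antisym_absorb]), and the
    square relation from the recursion [n+1] P_(n+1) = [n] P_n E P_n - [n-1] P_n
    and its mirror image, which expand both of its sides around the same middle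
    term ([square_shift_right], [square_shift_left], [web_relation_proj]). Since the
    trace is central, the value of a closed web does not change when the annulus is
    rotated. Hence the evaluation is well defined modulo the annular relations
    ([annular_eval_null]).

    Two values of it determine the statement. The bracket of a braid is evaluated to
    the trace of that braid ([eval_bracket]), because its two terms are the
    expression of a crossing through E. A circle of label k is evaluated to the
    trace of P_k, which the same recursion computes one strand at a time
    ([trace_proj_rec], [circles_value]): it is the product over i < k of
    (lam^-1 q^i - lam q^-i) / (q^-1 - q) / [i+1]. For lam = q^n this is the q-binomial,
    and for lam = a the HOMFLYPT value of the circle. So every expression of the
    bracket by circles evaluates to the normalized invariant of the closure.

    Instead of constructing the Hecke algebra, the proof lets its generators act on
    the space of functionals on braid words that satisfy the Hecke relations; the
    trace is a vector of this space, and all identities between elements of the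
    algebra are identities between operators. *)

Set Implicit Arguments.
Unset Strict Implicit.
Unset Printing Implicit Defensive.

Import GRing.Theory.
Local Open Scope ring_scope.

(** * Quantum integers *)
Section QuantumIntegers.
Variables (F : fieldType) (t : F).
Hypothesis t_generic : forall n, t ^+ n.+1 != 1.
Hypothesis t0 : t != 0.

Definition qnum (z : int) : F := (t ^ z - t ^ (- z)) / (t - t^-1).

Lemma subV_generic n : t ^+ n.+1 - (t ^+ n.+1)^-1 != 0.
Proof.
apply/eqP => /subr0_eq h; have := t_generic (n + n.+1).
by rewrite -addSn exprD {1}h mulVf ?expf_neq0 // eqxx.
Qed.

Lemma sqr_generic : t * t - 1 != 0.
Proof. by rewrite subr_eq0 -expr2 t_generic. Qed.

Lemma qnum0 : qnum 0 = 0.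
Proof. by rewrite /qnum oppr0 subrr mul0r. Qed.

Lemma qnum1 : qnum 1 = 1.
Proof.
rewrite /qnum -[t ^ (- 1)]/(t ^ (-1)) exprN1 expr1z divff //.
by have := subV_generic 0; rewrite expr1.
Qed.

Lemma qnum_neq0 n : qnum n.+1%:Z != 0.
Proof.
rewrite /qnum mulf_neq0 ?invr_eq0 //; first by rewrite -invr_expz subV_generic.
by have := subV_generic 0; rewrite expr1.
Qed.

Lemma qnum2 : qnum 2 = t + t^-1.
Proof.
have d1 := sqr_generic.
rewrite /qnum -!invr_expz -!exprnP !exprS expr0 mulr1.
by field; rewrite ?d1 ?t0.
Qed.

(** This makes the character that sends every generator to [2] take the value 1 on
the antisymmetrizers. *)
Lemma qnum_two n : qnum 2 * qnum n.+1%:Z = qnum n.+2%:Z + qnum n%:Z.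
Proof.
have hn : t ^+ n != 0 by rewrite expf_neq0.
have d1 := sqr_generic.
rewrite /qnum -!invr_expz -!exprnP !exprS expr0 mulr1.
by field; rewrite ?d1 ?t0 ?hn.
Qed.

(** The source of the q-Pascal rule, hence of the integrality of the
q-binomials. *)
Lemma qnum_add (x y : int) : qnum (x + y) = t ^ y * qnum x + t ^ (- x) * qnum y.
Proof.
rewrite /qnum !opprD !expfzDr // -!invr_expz.
have hx : t ^ x != 0 by rewrite expfz_neq0.
have hy : t ^ y != 0 by rewrite expfz_neq0.
have d1 := sqr_generic; move: (t ^ x) (t ^ y) hx hy => u v u0 v0.
by field; rewrite ?d1 ?t0 ?u0 ?v0.
Qed.

(** The scalar left over in the square relation. *)
Lemma qnum_det (k l : nat) :
  qnum k%:Z * qnum l.+1%:Z - qnum k.+1%:Z * qnum l%:Z = qnum (k%:Z - l%:Z).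
Proof.
have hk : t ^+ k != 0 by rewrite expf_neq0.
have hl : t ^+ l != 0 by rewrite expf_neq0.
have d1 := sqr_generic.
rewrite /qnum opprB !expfzDr // -!invr_expz -!exprnP !exprS.
by field; rewrite ?d1 ?t0 ?hk ?hl.
Qed.
End QuantumIntegers.

Lemma q_neq0 : q != 0.
Proof. by rewrite /q tofrac_eq0 polyX_eq0. Qed.

Lemma q_generic n : q ^+ n.+1 != 1.
Proof.
rewrite /q -tofracXn -tofrac1 tofrac_eq; apply/eqP => /(congr1 (size \o val)) /=.
by rewrite size_polyXn size_poly1.
Qed.

Definition qfact (n : nat) : Qq := \prod_(i < n) qint i.+1%:Z.

Lemma qint_neq0 n : qint n.+1%:Z != 0.
Proof. exact: (qnum_neq0 q_generic q_neq0). Qed.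

Lemma qfact_neq0 n : qfact n != 0.
Proof. by apply/prodf_neq0 => i _; exact: qint_neq0. Qed.

Lemma qbinom_fact n k : qbinom (n + k) k = qfact (n + k) / (qfact n * qfact k).
Proof.
rewrite /qbinom big_split /= prodfV invfM mulrA; congr (_ * _).
apply: (canRL (mulfK (qfact_neq0 n))).
rewrite {2}/qfact big_split_ord /= mulrC; congr (_ * _).
rewrite (reindex_inj rev_ord_inj) /=; apply: eq_bigr => i _; congr qint.
by rewrite subzn; [congr Posz; case: i => i /=; lia | case: i => i /=; lia].
Qed.

Lemma qbinom1 n : qbinom n 1 = qint n%:Z.
Proof.
rewrite /qbinom big_ord_recl big_ord0 mulr1 subr0.
by have -> : qint 1 = 1 := qnum1 q_generic q_neq0; rewrite divr1.
Qed.

Lemma qbinomn n : qbinom n n = 1.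
Proof.
have := qbinom_fact 0 n; rewrite add0n => ->.
by rewrite /qfact big_ord0 mul1r divff ?qfact_neq0.
Qed.

Lemma qbinomSn n : qbinom n.+1 n = qint n.+1%:Z.
Proof.
rewrite -[n.+1]add1n qbinom_fact /qfact big_ord_recl big_ord0 mulr1 big_ord_recr /= add1n.
have -> : qint 1 = 1 := qnum1 q_generic q_neq0; rewrite mul1r mulrC mulKf //.
exact: qfact_neq0.
Qed.

(** The splitting vertices carry q-binomial scalars, and this is exactly what
their associativity requires of those scalars. *)
Lemma qbinom_assoc k l p :
  qbinom (k + l + p) p * qbinom (k + l) l
  = qbinom (k + (l + p)) (l + p) * qbinom (l + p) p.
Proof.
have div_cancel (F : fieldType) (w x y z u v : F) : x != 0 -> y != 0 -> z != 0 ->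
    u != 0 -> v != 0 -> w / (z * x) * (z / (u * v)) = w / (u * y) * (y / (v * x)).
  by move=> hx hy hz hu hv; field; rewrite hx hy hz hu hv.
by rewrite !qbinom_fact -addnA; apply: div_cancel; exact: qfact_neq0.
Qed.

(** * The antisymmetrizers *)
Definition qn (K : fieldType) (f : Qq -> K) (n : nat) : K := f (qint n%:Z).
Notation "[ n ]_ f" := (qn f n) (at level 0, f at level 0, format "[ n ]_ f").

Section Hecke.

Variables (K : fieldType) (f : {rmorphism Qq -> K}) (M : lmodType K).

Lemma qn_neq0 n : [n.+1]_f != 0.
Proof. by rewrite /qn fmorph_eq0 qint_neq0. Qed.

Lemma qn0 : [0]_f = 0.
Proof. by rewrite /qn -(rmorph0 f); congr (f _); exact: qnum0. Qed.

Lemma qn1 : [1]_f = 1.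
Proof. by rewrite /qn -(rmorph1 f); congr (f _); exact: (qnum1 q_generic q_neq0). Qed.

Lemma qn_two n : [2]_f * [n.+1]_f = [n.+2]_f + [n]_f.
Proof.
by rewrite /qn -rmorphM -rmorphD; congr (f _); exact: (qnum_two q_generic q_neq0).
Qed.

Lemma qnI (V : lmodType K) n (x y : V) : [n.+1]_f *: x = [n.+1]_f *: y -> x = y.
Proof. exact: scalerI (qn_neq0 n) _ _. Qed.

Lemma scaleC (V : lmodType K) (c d : K) (x : V) : c *: (d *: x) = d *: (c *: x).
Proof. by rewrite !scalerA mulrC. Qed.

(** The relations of the Hecke algebra of n strands in terms of the images g i of
the dumbbell web E on the strands i and i+1, where a positive crossing is
q^-1 - E. In these generators the braid relation is
E_i E_(i+1) E_i - E_i = E_(i+1) E_i E_(i+1) - E_(i+1). *)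
Definition hecke (n : nat) (g : nat -> M -> M) : Prop :=
  [/\ forall i, (i.+1 < n)%N -> forall x, g i (g i x) = [2]_f *: g i x,
      forall i, (i.+2 < n)%N -> forall x,
        g i (g i.+1 (g i x)) - g i x = g i.+1 (g i (g i.+1 x)) - g i.+1 x
    & forall i j, (i.+1 < j)%N -> (j.+1 < n)%N -> forall x,
        g i (g j x) = g j (g i x)].

Lemma hecke_leq m n (h : nat -> M -> M) : (m <= n)%N -> hecke n h -> hecke m h.
Proof.
move=> mn [h1 h2 h3]; split=> i *; first by apply: h1; apply: leq_trans mn.
  by apply: h2; apply: leq_trans mn.
by apply: h3 => //; apply: leq_trans mn.
Qed.

(** The antisymmetrizing idempotent of n strands, through the recursion
[n+1] P' = [n] P g P - [n-1] P, where P is the antisymmetrizer of the first n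
strands and g the generator involving the last of the n+1 strands. *)
Fixpoint antisym (g : nat -> {linear M -> M}) (n : nat) : M -> M :=
  if n is (n'.+1 as k).+1 then
    fun x => [k.+1]_f^-1 *: ([k]_f *: antisym g k (g n' (antisym g k x))
                             - [n']_f *: antisym g k x)
  else id.
Arguments antisym : simpl never.

Section Family.
Variable g : nat -> {linear M -> M}.

Lemma antisymSS n x : [n.+2]_f *: antisym g n.+2 x
  = [n.+1]_f *: antisym g n.+1 (g n (antisym g n.+1 x))
    - [n]_f *: antisym g n.+1 x.
Proof. by rewrite /antisym -/antisym scalerA divff ?qn_neq0 // scale1r. Qed.

Lemma antisym2 x : [2]_f *: antisym g 2 x = g 0 x.
Proof. by rewrite antisymSS qn0 qn1 scale0r scale1r subr0. Qed.

Local Opaque antisym.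

(** Every later computation applies the recursion inside some linear F; doing it
once here keeps the unfolding of [antisym] out of those computations. *)
Lemma antisymSS_map (V : lmodType K) (F : {linear M -> V}) n x :
  [n.+2]_f *: F (antisym g n.+2 x)
  = [n.+1]_f *: F (antisym g n.+1 (g n (antisym g n.+1 x)))
    - [n]_f *: F (antisym g n.+1 x).
Proof. by rewrite -linearZZ antisymSS (linearB F) !linearZZ. Qed.

Lemma antisym_is_linear n : linear (antisym g n).
Proof.
elim: n => [//|[//|n] IH] c x y.
apply: (@qnI _ n.+1).
rewrite [RHS]scalerDr [_ *: (c *: _)]scalerA.
rewrite mulrC -scalerA !antisymSS IH (linearP (g n)) IH.
rewrite !scalerDr !scalerN !opprD !scalerA ![c * _]mulrC.
by rewrite addrACA.
Qed.

HB.instance Definition _ n :=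
  GRing.isLinear.Build K M M *:%R (antisym g n) (antisym_is_linear n).

End Family.
End Hecke.
Arguments antisym : simpl never.

Section HeckeTheory.
Variables (K : fieldType) (f : {rmorphism Qq -> K}).
Local Opaque antisym.

Lemma antisym_map (M M' : lmodType K) (g : nat -> {linear M -> M})
    (g' : nat -> {linear M' -> M'}) n (h : {linear M -> M'}) :
    (forall i, (i.+1 < n)%N -> forall x, h (g i x) = g' i (h x)) ->
  forall x, h (antisym f g n x) = antisym f g' n (h x).
Proof.
elim: n => [//|[//|n] IH] hg x.
have {}IH y : h (antisym f g n.+1 y) = antisym f g' n.+1 (h y).
  by apply: IH => i lin; apply: hg; apply: ltnW.
apply: (@qnI _ f _ n.+1).
by rewrite antisymSS_map antisymSS !IH hg // IH.
Qed.

Variable M : lmodType K.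
Local Notation antisym := (antisym f).
Local Notation hecke := (@hecke K f M).

Section Family.
Variable g : nat -> {linear M -> M}.

(** An antisymmetrizer is a combination of words in the generators whose value
under the character g i = [2] is 1: [n][2] - [n-1] = [n+1]. *)
Lemma antisym_fix n y :
    (forall i, (i.+1 < n)%N -> g i y = [2]_f *: y) -> antisym g n y = y.
Proof.
elim: n => [//|[//|n] IH] hy.
have {}IH : antisym g n.+1 y = y.
  by apply: IH => i lin; apply: hy; apply: ltnW.
apply: (@qnI _ f _ n.+1); rewrite antisymSS IH hy // linearZZ /= IH scalerA.
by rewrite -scalerBl mulrC qn_two addrK.
Qed.

Lemma antisym_cofix n (V : lmodType K) (F : {linear M -> V}) :
    (forall i, (i.+1 < n)%N -> forall x, F (g i x) = [2]_f *: F x) ->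
  forall x, F (antisym g n x) = F x.
Proof.
elim: n => [//|[//|n] IH] hF x.
have {}IH y : F (antisym g n.+1 y) = F y.
  by apply: IH => i lin; apply: hF; apply: ltnW.
apply: (@qnI _ f _ n.+1); rewrite antisymSS_map.
by rewrite !IH hF // IH scalerA -scalerBl mulrC qn_two addrK.
Qed.

(** Only the last generator f = g n.+1 needs work. Let P, Q be the antisymmetrizers
of one and two strands less and e = g n. Expanding the middle P in f P f P by
the recursion produces Q f e f P; the braid relation trades f e f for
e f e + f - e, and Q e Q is folded back into P by the recursion. The outcome is
[n+2] f P f P = [2] [n+2] P f P + [n+1] f P - [2] [n+1] P,
which says that f acts on [n+3] P' = [n+2] P f P - [n+1] P by [2]. The other
side is the mirror computation. *)
Lemma antisym_absorb n : hecke n g -> forall i, (i.+1 < n)%N -> forall x,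
  g i (antisym g n x) = [2]_f *: antisym g n x /\
  antisym g n (g i x) = [2]_f *: antisym g n x.
Proof.
elim/ltn_ind: n => -[//|[//|n]] IH hg i lin x.
have hP j y : (j.+1 < n.+1)%N -> g j (antisym g n.+1 y) = [2]_f *: antisym g n.+1 y
    /\ antisym g n.+1 (g j y) = [2]_f *: antisym g n.+1 y.
  by move=> lj; apply: IH => //; apply: hecke_leq hg.
have [h1 h2 h3] := hg.
have [lt_in|] := ltnP i n.
  split; apply: (@qnI _ f M n.+1).
  - rewrite antisymSS_map !(hP i _ _).1 //.
    by rewrite [RHS]scaleC antisymSS scalerBr; congr (_ - _); apply: scaleC.
  - rewrite antisymSS (hP i _ _).2 // (linearZZ (g n)) (linearZZ (antisym g n.+1)) /=.
    by rewrite [RHS]scaleC antisymSS scalerBr; congr (_ - _); apply: scaleC.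
rewrite leq_eqVlt => /orP[/eqP e|]; last by move: lin; lia.
rewrite -{i}e in lin *.
case: n => [|n] in IH hg hP h1 h2 h3 lin *.
  split; apply: (@qnI _ f M 1).
    by rewrite -(linearZZ (g 0)) antisym2 h1.
  by rewrite [LHS]antisym2 h1 // -(antisym2 f).
have QQ y : antisym g n.+1 (antisym g n.+2 y) = antisym g n.+2 y.
  by apply: antisym_fix => j lj; have [] := hP j y (ltnW lj).
have PQ y : antisym g n.+2 (antisym g n.+1 y) = antisym g n.+2 y.
  by apply: antisym_cofix => j lj z; have [] := hP j z (ltnW lj).
have Qf y : g n.+1 (antisym g n.+1 y) = antisym g n.+1 (g n.+1 y).
  by apply: antisym_map => j lj z; symmetry; apply: h3; rewrite ?ltnS.
have fef y : g n.+1 (g n (g n.+1 y)) = g n (g n.+1 (g n y)) - g n y + g n.+1 y.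
  by rewrite h2 // subrK.
have eP y : g n (antisym g n.+2 y) = [2]_f *: antisym g n.+2 y by have [] := hP n y.
have Pe y : antisym g n.+2 (g n y) = [2]_f *: antisym g n.+2 y by have [] := hP n y.
(* The recursion for P, read as a formula for Q e Q. *)
have QeQ (F : {linear M -> M}) y :
    [n.+1]_f *: F (antisym g n.+1 (g n (antisym g n.+1 y)))
    = [n.+2]_f *: F (antisym g n.+2 y) + [n]_f *: F (antisym g n.+1 y).
  by rewrite antisymSS_map subrK.
have alg (u v w z : M) : [n.+2]_f *: u = [2]_f *: ([n.+2]_f *: v)
    + [n.+1]_f *: w - [2]_f *: ([n.+1]_f *: z) ->
  [n.+2]_f *: u - [n.+1]_f *: w = [2]_f *: ([n.+2]_f *: v - [n.+1]_f *: z).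
  by move=> ->; rewrite scalerBr addrAC addrK.
have cancel (u v w z : M) : u + v - w + z - v = u + z - w.
  by rewrite addrAC [_ - w - v]addrAC addrK addrAC.
split; apply: (@qnI _ f M n.+2).
  rewrite antisymSS_map [RHS]scaleC [in RHS]antisymSS.
  apply: alg; have := eP x; have := QQ x; move: (antisym g n.+2 x) => y Qy ey.
  have Qfy : antisym g n.+1 (g n.+1 y) = g n.+1 y by rewrite -Qf Qy.
  rewrite antisymSS_map Qfy Qf fef h1 // ey (linearD (antisym _ _)) (linearB (antisym _ _)) /=.
  rewrite (linearZZ (g n.+1)) (linearZZ (g n)) !(linearZZ (antisym g n.+1)) /=.
  rewrite Qy Qfy scalerDr scalerBr [[n.+1]_f *: ([2]_f *: _)]scaleC.
  rewrite -{1}Qfy (QeQ idfun) /= scalerDr Qfy.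
  by rewrite ![[_]_f *: ([2]_f *: _)]scaleC; apply: cancel.
rewrite antisymSS [RHS]scaleC [in RHS]antisymSS.
apply: alg.
have PfQ z : antisym g n.+2 (g n.+1 (antisym g n.+1 z)) = antisym g n.+2 (g n.+1 z).
  by rewrite Qf PQ.
have -> := antisymSS_map f g (antisym g n.+2 \o g n.+1) n (g n.+1 x).
rewrite /= -Qf PfQ fef (linearD (antisym g n.+2)) (linearB (antisym g n.+2)) /=.
rewrite !Pe h1 // (linearZZ (antisym g n.+2)) /= PfQ PQ.
have /= e := QeQ (antisym g n.+2 \o g n.+1) x.
rewrite !PfQ in e.
rewrite scalerDr scalerBr [[n.+1]_f *: ([2]_f *: antisym _ _ (g _ _))]scaleC e.
rewrite scalerDr [[n.+1]_f *: ([2]_f *: _)]scaleC.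
rewrite [[n]_f *: ([2]_f *: _)]scaleC; apply: cancel.
Qed.

End Family.

(** An antisymmetrizer depends only on the set of generators, not on the order in
which the recursion adds the strands: both products of two candidates can be
evaluated by absorption. *)
Lemma antisym_unique n (g h : nat -> {linear M -> M}) :
    hecke n g -> hecke n h ->
    (forall i, (i.+1 < n)%N -> exists2 j, (j.+1 < n)%N & g i =1 h j) ->
    (forall i, (i.+1 < n)%N -> exists2 j, (j.+1 < n)%N & h i =1 g j) ->
  antisym g n =1 antisym h n.
Proof.
move=> hg hh gh hg' x.
have <- : antisym g n (antisym h n x) = antisym h n x.
  by apply: antisym_fix => i /gh[j lj ->]; apply: (antisym_absorb hh lj x).1.
symmetry; apply: (antisym_cofix (F := antisym g n)) => i /hg'[j lj e] y.
by rewrite e; apply: (antisym_absorb hg lj y).2.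
Qed.

Lemma hecke_rev n (g h : nat -> {linear M -> M}) : hecke n g ->
  (forall i, (i.+1 < n)%N -> h i =1 g (n - i.+2)%N) -> hecke n h.
Proof.
move=> [h1 h2 h3] e; split.
- by move=> i li x; rewrite !e // h1 //; lia.
- move=> i li x; rewrite !(e i) ?(ltnW li) // !(e i.+1) //.
  have -> : (n - i.+2 = (n - i.+3).+1)%N by lia.
  by symmetry; apply: h2; lia.
- move=> i j ij lj x; have li : (i.+1 < n)%N by lia.
  by rewrite !(e i) // !(e j) //; symmetry; apply: h3; lia.
Qed.

(** The recursion that adds the strands from right to left. Together with
[antisymSS] it expands the two different merges of the square relation around
the same middle generator. *)
Lemma antisymSS_left (g : nat -> {linear M -> M}) n x : hecke n.+2 g ->
  let P := antisym (g \o S) n.+1 in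
  [n.+2]_f *: antisym g n.+2 x = [n.+1]_f *: P (g 0 (P x)) - [n]_f *: P x.
Proof.
move=> hg P; pose h i := g (n - i)%N.
have hh : hecke n.+2 h by apply: hecke_rev hg _ => i _ y; rewrite /h subSS.
have hS : hecke n.+1 (g \o S).
  have [h1 h2 h3] := hg; split=> i *; [exact: h1 | exact: h2 | exact: h3].
have gh : antisym g n.+2 =1 antisym h n.+2.
  apply: antisym_unique => // i li; exists (n - i)%N => [|y]; rewrite /h ?ltnS ?leq_subr //.
  by rewrite subKn.
have PP : antisym h n.+1 =1 P.
  apply: antisym_unique => //; first by apply: hecke_leq hh.
    move=> i li; exists (n - i.+1)%N => [|y]; first lia.
    by rewrite /h /= subnSK.
  move=> i li; exists (n - i.+1)%N => [|y]; first lia.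
  by rewrite /h /= subKn.
by rewrite gh antisymSS !PP /h subnn.
Qed.
End HeckeTheory.

(** * Webs as operators *)
(** Webs of total width N act on a representation of the Hecke algebra of N
strands: an edge of label k is a bundle of k strands carrying an
antisymmetrizer. *)
Section Webs.
Variables (K : fieldType) (f : {rmorphism Qq -> K}) (M : lmodType K).
Variables (N : nat) (e : nat -> {linear M -> M}).
Hypothesis he : hecke f N e.

Definition proj a k : M -> M := antisym f (fun i => e (a + i)%N) k.
HB.instance Definition _ a k := GRing.Linear.on (proj a k).

Lemma hecke_shift a k : (a + k <= N)%N -> hecke f k (fun i => e (a + i)%N).
Proof.
move=> ak; have [h1 h2 h3] := he; split.
- by move=> i li x; apply: h1; lia.
- by move=> i li x; rewrite addnS; apply: h2; lia.
- by move=> i j ij lj x; apply: h3; lia.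
Qed.

Lemma proj_gen a k i x : (a + k <= N)%N -> (a <= i)%N -> (i.+1 < a + k)%N ->
  e i (proj a k x) = [2]_f *: proj a k x /\ proj a k (e i x) = [2]_f *: proj a k x.
Proof.
move=> ak ai ik; have li : ((i - a).+1 < k)%N by lia.
by have := antisym_absorb (hecke_shift ak) li x; rewrite /= subnKC.
Qed.

Lemma proj_subl a k b l x : (a <= b)%N -> (b + l <= a + k)%N -> (a + k <= N)%N ->
  proj b l (proj a k x) = proj a k x.
Proof.
by move=> ab bl ak; apply: antisym_fix => i li; apply: (proj_gen x ak _ _).1; lia.
Qed.

Lemma proj_subr a k b l x : (a <= b)%N -> (b + l <= a + k)%N -> (a + k <= N)%N ->
  proj a k (proj b l x) = proj a k x.
Proof.
move=> ab bl ak; apply: (antisym_cofix (F := proj a k)) => i li y.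
by apply: (proj_gen y ak _ _).2; lia.
Qed.

(** Antisymmetrizers on disjoint intervals of strands only involve distant
generators. *)
Lemma proj_commute a k b l x : (a + k <= b)%N -> (b + l <= N)%N ->
  proj a k (proj b l x) = proj b l (proj a k x).
Proof.
move=> ab bN; apply: (@antisym_map _ _ _ _ _ _ _ (proj a k)) => i li y /=.
symmetry; apply: (@antisym_map _ _ _ _ _ _ _ (e (b + i)%N)) => j lj z.
by have [_ _ h3] := he; symmetry; apply: h3; lia.
Qed.

Lemma proj_S a k (F : {linear M -> M}) x : [k.+2]_f *: F (proj a k.+2 x) =
  [k.+1]_f *: F (proj a k.+1 (e (a + k) (proj a k.+1 x))) - [k]_f *: F (proj a k.+1 x).
Proof. exact: antisymSS_map. Qed.

Lemma proj_S_left a k (F : {linear M -> M}) x : (a + k.+2 <= N)%N ->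
  [k.+2]_f *: F (proj a k.+2 x) =
  [k.+1]_f *: F (proj a.+1 k.+1 (e a (proj a.+1 k.+1 x))) - [k]_f *: F (proj a.+1 k.+1 x).
Proof.
move=> ak; rewrite -!(linearZZ F) -(linearB F); congr (F _).
rewrite /proj antisymSS_left; last exact: hecke_shift.
rewrite /= addn0; have -> // : (fun i => e (a + i)%N) \o S = (fun i => e (a.+1 + i)%N).
by apply/funext => i /=; rewrite addnS.
Qed.

(** The idempotent attached to a row of edges s, starting at strand a. *)
Fixpoint projs a (s : seq nat) : M -> M :=
  if s is k :: s' then proj a k \o projs (a + k)%N s' else id.

Lemma projs_is_linear a s : linear (projs a s).
Proof.
by elim: s a => [//|k s IH] a c x y; rewrite /= IH (linearP (proj a k)).
Qed.
HB.instance Definition _ a s :=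
  GRing.isLinear.Build K M M *:%R (projs a s) (projs_is_linear a s).

Lemma projs_cat a s t x : projs a (s ++ t) x = projs a s (projs (a + sumn s) t x).
Proof. by elim: s a => [|k s IH] a /=; rewrite ?addn0 // IH addnA. Qed.

Lemma projs_commute a k b s x : (a + k <= b)%N -> (b + sumn s <= N)%N ->
  proj a k (projs b s x) = projs b s (proj a k x).
Proof.
elim: s b => [//|l s IH] b /= ab bN.
by rewrite proj_commute ?IH //; lia.
Qed.

Lemma projs_commute_r a k b s x : (b + sumn s <= a)%N -> (a + k <= N)%N ->
  proj a k (projs b s x) = projs b s (proj a k x).
Proof.
elim: s b => [//|l s IH] b /= ab bN.
by rewrite -proj_commute ?IH //; lia.
Qed.

Lemma projs_projs_commute a s b t x : (a + sumn s <= b)%N -> (b + sumn t <= N)%N ->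
  projs a s (projs b t x) = projs b t (projs a s x).
Proof.
elim: s a => [//|k s IH] a /= ab bN.
by rewrite IH ?projs_commute //; lia.
Qed.

Lemma projs_ones a n x : projs a (nseq n 1%N) x = x.
Proof. by elim: n a => [//|n IH] a /=; rewrite IH. Qed.

(** Antisymmetrizing k + l strands absorbs the antisymmetrizers of the two legs, so
the same projector serves for merging and splitting; the q-binomial on one of
them accounts for the digon relation. *)
Definition vertex_op a v : M -> M := match v with
  | Merge k l => proj a (k + l)
  | Split k l => f (qbinom (k + l) l) \*: proj a (k + l)
  end.

Lemma vertex_op_is_linear a v : linear (vertex_op a v).
Proof.
by case: v => k l c x y; rewrite /= ?linearP // scalerDr scaleC.
Qed.
HB.instance Definition _ a v :=
  GRing.isLinear.Build K M M *:%R (vertex_op a v) (vertex_op_is_linear a v).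

(** The labels on the left of a vertex determine the strand at which it acts. *)
Fixpoint web_op a (W : diagram nat vertex) : M -> M :=
  if W is (L, v, _) :: W' then vertex_op (a + sumn L) v \o web_op a W' else id.

Lemma web_op_is_linear a W : linear (web_op a W).
Proof.
by elim: W => [//|[[L v] R] W IH] c x y; rewrite /= IH (linearP (vertex_op _ _)).
Qed.
HB.instance Definition _ a W :=
  GRing.isLinear.Build K M M *:%R (web_op a W) (web_op_is_linear a W).

Lemma web_op_cat a W1 W2 x : web_op a (W1 ++ W2) x = web_op a W1 (web_op a W2 x).
Proof. by elim: W1 => [//|[[L v] R] W IH] /=; rewrite IH. Qed.

Lemma web_op_whisker a L W R x : web_op a (whisker L W R) x = web_op (a + sumn L) W x.
Proof. by elim: W => [//|[[L' v] R'] W IH] /=; rewrite IH sumn_cat addnA. Qed.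

Lemma sumn_vsrc v : sumn (vsrc v) = sumn (vtgt v).
Proof. by case: v => k l /=; rewrite !addn0. Qed.

Lemma vertex_opE a v : exists c : K, forall x, vertex_op a v x = c *: proj a (sumn (vsrc v)) x.
Proof.
case: v => k l /=; rewrite !addn0; last by exists (f (qbinom (k + l) l)).
by exists 1 => x; rewrite scale1r.
Qed.

Lemma vertex_op_commute a v b w x : (a + sumn (vsrc v) <= b)%N -> (b + sumn (vsrc w) <= N)%N ->
  vertex_op a v (vertex_op b w x) = vertex_op b w (vertex_op a v x).
Proof.
have [c hc] := vertex_opE a v; have [d hd] := vertex_opE b w => ab bN.
rewrite !hc !hd (linearZZ (proj a _)) (linearZZ (proj b _)) scaleC.
by rewrite /= proj_commute.
Qed.

Lemma projs_vsrc a v x : (a + sumn (vsrc v) <= N)%N ->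
  projs a (vsrc v) (vertex_op a v x) = vertex_op a v x.
Proof.
case: v => k l /=; rewrite !addn0 => aN.
  by rewrite [proj (a + k) l _]proj_subl ?proj_subl //; lia.
by rewrite linearZZ /= proj_subl //; lia.
Qed.

Lemma projs_vtgt a v x : (a + sumn (vsrc v) <= N)%N ->
  vertex_op a v (projs a (vtgt v) x) = vertex_op a v x.
Proof.
case: v => k l /=; rewrite !addn0 => aN; first by rewrite proj_subr //; lia.
by congr (_ *: _); rewrite proj_subr ?proj_subr //; lia.
Qed.

Lemma vertex_op_projs_commute a v b s x :
    (a + sumn (vsrc v) <= b)%N -> (b + sumn s <= N)%N ->
  vertex_op a v (projs b s x) = projs b s (vertex_op a v x).
Proof.
have [c hc] := vertex_opE a v => ab bN.
by rewrite !hc projs_commute // (linearZZ (projs _ _)).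
Qed.

Lemma projs_slice a L v R x : (a + sumn (L ++ vsrc v ++ R) <= N)%N ->
  projs a (L ++ vsrc v ++ R) (vertex_op (a + sumn L) v x)
  = vertex_op (a + sumn L) v (projs a (L ++ vtgt v ++ R) x).
Proof.
rewrite !sumn_cat => aN; rewrite !projs_cat -sumn_vsrc.
rewrite -vertex_op_projs_commute; [|lia|lia].
rewrite projs_vsrc; last lia.
have [c hc] := vertex_opE (a + sumn L) v.
rewrite [RHS]hc projs_commute_r; [|lia|lia].
rewrite -(linearZZ (projs a L)) -hc projs_vtgt; last lia.
by [].
Qed.

Lemma typed_sumn s W t : typed vsrc vtgt s W t -> sumn s = sumn t.
Proof.
elim: W s => [|[[L v] R] W IH] s /=; first by move=> /eqP->.
by case/andP=> /eqP-> /IH <-; rewrite !sumn_cat sumn_vsrc.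
Qed.

(** The idempotent of the bottom row may be moved to any level of the web, in
particular next to the place where a local relation is applied. *)
Lemma projs_web a s W t x : typed vsrc vtgt s W t -> (a + sumn s <= N)%N ->
  projs a s (web_op a W x) = web_op a W (projs a t x).
Proof.
elim: W s => [|[[L v] R] W IH] s /=; first by move=> /eqP->.
case/andP=> /eqP-> tW aN; rewrite projs_slice // (IH _ tW) //.
by move: aN; rewrite !sumn_cat sumn_vsrc.
Qed.
End Webs.

(** * The web relations hold *)
Section Relations.
Variables (K : fieldType) (f : {rmorphism Qq -> K}) (M : lmodType K).
Variables (N : nat) (e : nat -> {linear M -> M}).
Hypothesis he : hecke f N e.

Local Notation proj := (proj f e).
Local Notation projs := (projs f e).
Local Notation vertex_op := (vertex_op f e).
Local Notation web_op := (web_op f e).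

Lemma vertex_op_erased a v x : (sumn (vsrc v) <= 1)%N -> vertex_op a v x = x.
Proof.
case: v => k l /=; rewrite addn0; first by case: (k + l)%N => [|[|]].
case: k l => [|[|k]] [|[|l]] //= _; rewrite ?add0n ?qbinomn ?rmorph1 ?scale1r //.
by rewrite /qbinom big_ord0 rmorph1 scale1r.
Qed.

Lemma sumn_erase s : sumn (filter (leq 1) s) = sumn s.
Proof. by elim: s => [//|[|k] s /= ->]. Qed.

(** A vertex with an erased leg merges or splits a single strand, so it acts
trivially. *)
Lemma web_op_erase0 a W x :
    all (fun y => vpos y.1.2 || (sumn (vsrc y.1.2) <= 1)%N) W ->
  web_op a (erase0 W) x = web_op a W x.
Proof.
elim: W => [//|[[L v] R] W IH] /= /andP[hv /IH {}IH].
rewrite /erase0 /=; case: ifP hv => /= [_ _|_ hv]; last by rewrite IH vertex_op_erased.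
by rewrite sumn_erase -/(erase0 W) IH.
Qed.

Section Square.
Variables (a k l : nat).
Hypothesis aN : (a + (k.+1 + l.+1) <= N)%N.
Local Notation Pl := (proj a k.+1).
Local Notation Pr := (proj (a + k).+1 l.+1).
Local Notation PP := (projs a [:: k.+1; l.+1]).

Lemma square_projs x : PP x = Pl (Pr x).
Proof. by rewrite /= addnS. Qed.

Lemma square_idem x : [/\ PP (Pl x) = PP x, PP (Pr x) = PP x & Pr (Pl x) = PP x].
Proof.
have C y : Pl (Pr y) = Pr (Pl y) by rewrite (proj_commute he) //; lia.
rewrite !square_projs; split; last by rewrite C.
  by rewrite -[Pr (Pl x)]C (proj_subl he) //; lia.
by rewrite [Pr (Pr x)](proj_subl he) //; lia.
Qed.

(** Between the idempotents of the two edges, the fat edge of label l + 2 is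
expanded by the recursion that adds its leftmost strand; all the
antisymmetrizers on l + 1 strands are then absorbed. *)
Lemma square_shift_right x :
  PP (web_op a (shift_right k l.+1 ++ shift_left k l.+1) x)
  = ([k.+1]_f * [l.+1]_f) *: PP (e (a + k)%N (PP x)) - ([k.+1]_f * [l]_f) *: PP x.
Proof.
have hZ c y : PP (c *: y) = c *: PP y by exact: linearZZ.
have P1 y : PP (Pl y) = PP y by case: (square_idem y).
have P2 y : PP (Pr y) = PP y by case: (square_idem y).
have P3 y : Pr (Pl y) = PP y by case: (square_idem y).
have -> : web_op a (shift_right k l.+1 ++ shift_left k l.+1) x
    = [k.+1]_f *: Pl ([l.+2]_f *: proj (a + k) l.+2 (Pl x)).
  rewrite /= !addn0 !addn1 !add1n qbinom1 qbinomSn (linearZZ (proj (a + k) _)) /=.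
  by rewrite (proj_subl he) //; lia.
have -> : PP ([k.+1]_f *: Pl ([l.+2]_f *: proj (a + k) l.+2 (Pl x)))
    = [k.+1]_f *: ([l.+1]_f *: PP (Pr (e (a + k)%N (Pr (Pl x)))) - [l]_f *: PP (Pr (Pl x))).
  by rewrite hZ P1 hZ; congr (_ *: _); apply: (proj_S_left he PP); lia.
by rewrite !P2 P3 P1 scalerBr !scalerA.
Qed.

(** The mirror image of the previous expansion: the middle term is the same, so it
cancels in the square relation. *)
Lemma square_shift_left x :
  PP (web_op a (shift_left k.+1 l ++ shift_right k.+1 l) x)
  = ([k.+1]_f * [l.+1]_f) *: PP (e (a + k)%N (PP x)) - ([k]_f * [l.+1]_f) *: PP x.
Proof.
have hZ c y : PP (c *: y) = c *: PP y by exact: linearZZ.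
have P1 y : PP (Pl y) = PP y by case: (square_idem y).
have P2 y : PP (Pr y) = PP y by case: (square_idem y).
have P3 y : Pl (Pr y) = PP y by rewrite square_projs.
have -> : web_op a (shift_left k.+1 l ++ shift_right k.+1 l) x
    = [l.+1]_f *: Pr ([k.+2]_f *: proj a k.+2 (Pr x)).
  rewrite /= !addn0 !addn1 !add1n qbinom1 qbinomSn (linearZZ (proj a _)) /= !addnS.
  by rewrite [proj a k.+2 _](proj_subl he) //; lia.
have -> : PP ([l.+1]_f *: Pr ([k.+2]_f *: proj a k.+2 (Pr x)))
    = [l.+1]_f *: ([k.+1]_f *: PP (Pl (e (a + k)%N (Pl (Pr x)))) - [k]_f *: PP (Pl (Pr x))).
  by rewrite hZ P2 hZ; congr (_ *: _); apply: (proj_S f e a k PP).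
by rewrite !P1 P3 P2 scalerBr !scalerA ![[l.+1]_f * _]mulrC.
Qed.
End Square.

Lemma qn_det k l : [k]_f * [l.+1]_f - [k.+1]_f * [l]_f = f (qint (k%:Z - l%:Z)).
Proof.
rewrite /qn -!rmorphM -rmorphB; congr (f _).
exact: (qnum_det q_generic q_neq0).
Qed.

Lemma web_relation_proj s t r a x : web_relation s t r -> (a + sumn s <= N)%N ->
  \sum_(y <- r) f y.1 *: projs a s (web_op a y.2 x) = 0.
Proof.
case=> [{}s {}t W1 W2 [v L w]|k l p|k l p|k l|k l] aN.
- rewrite !big_cons big_nil addr0 rmorph1 rmorphN rmorph1 scale1r scaleN1r.
  apply/eqP; rewrite subr_eq0; apply/eqP; congr (projs _ _ _).
  move: aN; rewrite /= !sumn_cat /= addn0 -sumn_vsrc => aN.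
  by rewrite (vertex_op_commute he) //; lia.
- rewrite !big_cons big_nil addr0 rmorph1 rmorphN rmorph1 scale1r scaleN1r.
  apply/eqP; rewrite subr_eq0; apply/eqP; congr (projs _ _ _).
  move: aN; rewrite /= !addn0 => aN.
  by rewrite !(proj_subl he) ?addnA //; lia.
- rewrite !big_cons big_nil addr0 rmorph1 rmorphN rmorph1 scale1r scaleN1r.
  apply/eqP; rewrite subr_eq0; apply/eqP; congr (projs _ _ _).
  move: aN; rewrite /= !addn0 => aN.
  rewrite (linearZZ (proj a (k + l + p))) (linearZZ (proj a (k + (l + p)))) /=.
  rewrite !(proj_subr he) ?addnA //; try lia.
  by rewrite !scalerA -!rmorphM qbinom_assoc addnA.
- rewrite !big_cons big_nil addr0 rmorph1 rmorphN scale1r scaleNr.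
  move: aN; rewrite /= !addn0 => aN.
  by rewrite (linearZZ (proj a _)) /= !(proj_subl he) ?subrr //; lia.
- rewrite !big_cons big_nil addr0 rmorph1 !rmorphN rmorph1 scale1r scaleN1r scaleNr.
  rewrite !web_op_erase0; last 2 first.
  + by case: (k) (l) => [|?] [|?]; rewrite /= ?addn0 ?addn1 ?add1n.
  + by case: (k) (l) => [|?] [|?]; rewrite /= ?addn0 ?addn1 ?add1n.
  have {}aN : (a + (k.+1 + l.+1) <= N)%N by move: aN; rewrite /= addn0.
  rewrite square_shift_right ?square_shift_left; try lia.
  have -> : k.+1%:Z - l.+1%:Z = k%:Z - l%:Z by lia.
  rewrite opprB -qn_det scalerBl opprB /=.
  by rewrite [_ - _ + (_ - _)]addrC !addrA subrK subrK subrr.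
Qed.

(** The idempotents of the edges on both sides of a local relation commute with
everything that happens inside it. *)
Lemma web_relation_projs s t r a L R x : web_relation s t r ->
    (a + sumn (L ++ s ++ R) <= N)%N ->
  \sum_(y <- r) f y.1 *: projs a (L ++ s ++ R) (web_op a (whisker L y.2 R) x) = 0.
Proof.
rewrite !sumn_cat => rel aN.
transitivity (projs a L (projs (a + sumn L + sumn s) R
  (\sum_(y <- r) f y.1 *: projs (a + sumn L) s (web_op (a + sumn L) y.2 x)))).
  rewrite !raddf_sum /=; apply: eq_bigr => y _.
  rewrite !projs_cat web_op_whisker.
  rewrite -!linearZZ; congr (projs _ _ _).
  by rewrite -(projs_projs_commute he) //; lia.
by rewrite (web_relation_proj _ rel) ?raddf0 //; lia.
Qed.
End Relations.

(** * The module of Hecke functionals on braids *)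
Section Functionals.
Variables (K : fieldType) (f : {rmorphism Qq -> K}) (m : nat).

Local Notation t := (f q).

(** Linear functionals on the Hecke algebra, presented as functions on braid words.
They form a representation of the Hecke algebra by right translation, and the
trace of an invariant is one of its vectors. The relations that involve several
negative crossings follow from the skein relation, which expresses them through
positive ones. *)
Definition hecke_functional (phi : braid m -> K^o) : Prop :=
  [/\ forall u v i,
        phi (u ++ (true, i) :: v) - phi (u ++ (false, i) :: v) = (t^-1 - t) * phi (u ++ v),
      forall u v i, phi (u ++ [:: (true, i), (false, i) & v]) = phi (u ++ v),
      forall u v (i j : 'I_m.-1), j = i.+1 :> nat ->
        phi (u ++ [:: (true, i), (true, j), (true, i) & v])
        = phi (u ++ [:: (true, j), (true, i), (true, j) & v])
    & forall u v (i j : 'I_m.-1), (i.+1 < j)%N ->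
        phi (u ++ [:: (true, i), (true, j) & v]) = phi (u ++ [:: (true, j), (true, i) & v])].

Definition hecke_pred : {pred braid m -> K^o} := fun phi => `[< hecke_functional phi >].

Lemma hecke_submod : submod_closed hecke_pred.
Proof.
split=> [|c p r /asboolP[p1 p2 p3 p4] /asboolP[r1 r2 r3 r4]]; apply/asboolP.
  have z u : (0 : braid m -> K^o) u = 0 by [].
  by split=> *; rewrite !z // subrr mulr0.
split=> [u v i|u v i|u v i j ij|u v i j ij]; rewrite !fctE.
- rewrite opprD addrACA -scalerBr p1 r1 mulrDr; congr (_ + _).
  by rewrite /GRing.scale /= mulrCA.
- by rewrite p2 r2.
- by rewrite p3 // r3.
- by rewrite p4 // r4.
Qed.
HB.instance Definition _ :=
  GRing.isSubmodClosed.Build K (braid m -> K^o) hecke_pred hecke_submod.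

Record hspace := HSpace { hfun :> braid m -> K^o; _ : hfun \in hecke_pred }.
HB.instance Definition _ := [isSub for hfun].
HB.instance Definition _ := [Choice of hspace by <:].
HB.instance Definition _ := [SubChoice_isSubLmodule of hspace by <:].

Lemma hfunP (phi : hspace) : hecke_functional phi.
Proof. exact/asboolP/(valP phi). Qed.

Lemma hfun_ext (phi psi : hspace) : (forall u, phi u = psi u) -> phi = psi.
Proof. by move=> h; apply/val_inj/funext. Qed.

Lemma hfunD (phi psi : hspace) u : (phi + psi) u = phi u + psi u.
Proof. by []. Qed.
Lemma hfunN (phi : hspace) u : (- phi) u = - phi u.
Proof. by []. Qed.
Lemma hfunZ c (phi : hspace) u : (c *: phi) u = c * phi u.
Proof. by []. Qed.
Lemma hfun_sum (I : Type) (r : seq I) (F : I -> hspace) u :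
  (\sum_(i <- r) F i) u = \sum_(i <- r) F i u.
Proof. by elim: r => [|i r IH]; rewrite ?big_nil // !big_cons hfunD IH. Qed.

Lemma shift_subproof w (phi : hspace) : (fun u => phi (u ++ w)) \in hecke_pred.
Proof.
apply/asboolP; have [h1 h2 h3 h4] := hfunP phi.
by split=> *; rewrite -!catA /= ?h1 ?h2 // -?catA; [apply: h3|apply: h4].
Qed.
Definition shift w phi := HSpace (shift_subproof w phi).

Lemma shiftE w phi u : shift w phi u = phi (u ++ w).
Proof. by []. Qed.

(** The action of the dumbbell web E = q^-1 - (positive crossing). *)
Definition gen (i : nat) (phi : hspace) : hspace :=
  if insub i is Some j then t^-1 *: phi - shift [:: (true, j)] phi else 0.

Lemma gen_is_linear i : linear (gen i).
Proof.
move=> c phi psi; rewrite /gen; case: insub => [j|]; last by rewrite scaler0 addr0.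
apply: hfun_ext => u; rewrite !(hfunD, hfunN, hfunZ, shiftE); ring.
Qed.
HB.instance Definition _ i := GRing.isLinear.Build K hspace hspace *:%R (gen i) (gen_is_linear i).

Lemma genE (i : 'I_m.-1) phi u : gen i phi u = t^-1 * phi u - phi (u ++ [:: (true, i)]).
Proof. by rewrite /gen valK. Qed.

(** The quadratic relation of the skein turns the square of a crossing into a
combination of the crossing and the identity; the rest is a computation. *)
Lemma gen_hecke : hecke f m gen.
Proof.
have t0 : t != 0 by rewrite fmorph_eq0 q_neq0.
have two : [2]_f = t + t^-1.
  by rewrite -fmorphV -rmorphD; congr (f _); exact: (qnum2 q_generic q_neq0).
have sqr (phi : hspace) u l : phi (u ++ [:: (true, l); (true, l)])
      = phi u + (t^-1 - t) * phi (u ++ [:: (true, l)]).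
  have [h1 h2 _ _] := hfunP phi; have := h1 (u ++ [:: (true, l)]) [::] l.
  by rewrite -!catA /= h2 cats0 => <-; rewrite addrC subrK.
have ordE i : (i < m.-1)%N -> exists k : 'I_m.-1, k = i :> nat.
  by move=> li; exists (Ordinal li).
split.
- move=> i li phi; have [|k <-] := ordE i; first by lia.
  apply: hfun_ext => u.
  suff : gen k (gen k phi) u = [2]_f * gen k phi u by [].
  by rewrite !genE -!catA /= sqr two; field.
- move=> i li phi.
  have [|k kE] := ordE i; first by lia.
  have [|j jE] := ordE i.+1; first by lia.
  have jk : j = k.+1 :> nat by rewrite jE kE.
  rewrite -jE -kE; apply: hfun_ext => u; have [h1 h2 h3 _] := hfunP phi.
  suff : gen k (gen j (gen k phi)) u - gen k phi u
       = gen j (gen k (gen j phi)) u - gen j phi u by [].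
  rewrite !genE -!catA /= h3 // !sqr.
  by field.
- move=> i j ij lj phi.
  have [|k kE] := ordE i; first by lia.
  have [|l lE] := ordE j; first by lia.
  rewrite -kE -lE in ij *; apply: hfun_ext => u; have [_ _ _ h4] := hfunP phi.
  by rewrite !genE -!catA /= h4 //; ring.
Qed.
End Functionals.

(** * The annular evaluation defined by a Markov trace *)
Section WordOperators.
Variables (K : fieldType) (f : {rmorphism Qq -> K}) (m : nat).
Local Notation H := (hspace f m).
Local Notation gen := (@gen K f m).

(** The operators that come from linear combinations of braid words: on products of
these, a central functional is cyclic. *)
Definition word_op (X : H -> H) : Prop := exists r : seq (K * braid m),
  forall phi u, X phi u = \sum_(x <- r) x.1 * phi (u ++ x.2).

Lemma word_op_id : word_op id.
Proof. by exists [:: (1, [::])] => phi u; rewrite big_seq1 mul1r cats0. Qed.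

Lemma word_op_shift w : word_op (shift w).
Proof. by exists [:: (1, w)] => phi u; rewrite big_seq1 mul1r. Qed.

Lemma word_op_comp X Y : word_op X -> word_op Y -> word_op (X \o Y).
Proof.
move=> [r hr] [s hs]; exists [seq (x.1 * y.1, x.2 ++ y.2) | x <- r, y <- s] => phi u.
rewrite big_allpairs_dep hr; apply: eq_bigr => x _; rewrite hs mulr_sumr.
by apply: eq_bigr => y _; rewrite catA mulrA.
Qed.

Lemma word_op_scale c X : word_op X -> word_op (fun phi => c *: X phi).
Proof.
move=> [r hr]; exists [seq (c * x.1, x.2) | x <- r] => phi u.
rewrite big_map; suff : c * X phi u = \sum_(j <- r) c * j.1 * phi (u ++ j.2) by [].
by rewrite hr mulr_sumr; apply: eq_bigr => x _; rewrite mulrA.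
Qed.

Lemma word_op_sub X Y : word_op X -> word_op Y -> word_op (fun phi => X phi - Y phi).
Proof.
move=> [r hr] [s hs]; exists (r ++ [seq (- x.1, x.2) | x <- s]) => phi u.
rewrite hfunD hfunN hr hs big_cat big_map /= -sumrN; congr (_ + _).
by apply: eq_bigr => x _; rewrite mulNr.
Qed.

Lemma word_op_gen i : word_op (gen i).
Proof.
rewrite /gen; case: insub => [j|].
  exact: word_op_sub (word_op_scale _ word_op_id) (word_op_shift _).
by exists [::] => phi u; rewrite big_nil.
Qed.

Lemma word_op_antisym (g : nat -> {linear H -> H}) n :
  (forall i, word_op (g i)) -> word_op (antisym f g n).
Proof.
move=> hg; elim: n => [|[|n] IH]; [exact: word_op_id | exact: word_op_id |].
apply: (@word_op_scale _ (fun phi => _ *: _ - _)).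
by apply: word_op_sub; apply: word_op_scale => //;
   apply: (@word_op_comp _ (_ \o _)) => //; apply: word_op_comp.
Qed.

Lemma word_op_proj a k : word_op (proj f gen a k).
Proof. by apply: word_op_antisym => i; apply: word_op_gen. Qed.

Lemma word_op_projs a s : word_op (projs f gen a s).
Proof.
elim: s a => [|k s IH] a; first exact: word_op_id.
exact: word_op_comp (word_op_proj _ _) (IH _).
Qed.

Lemma word_op_web a W : word_op (web_op f gen a W).
Proof.
elim: W => [|[[L v] R] W IH]; first exact: word_op_id.
apply: word_op_comp IH; case: v => k l; first exact: word_op_proj.
exact: word_op_scale (word_op_proj _ _).
Qed.

Lemma word_op_cyclic (T : H) X Y : (forall u v, T (u ++ v) = T (v ++ u)) ->
  word_op X -> word_op Y -> X (Y T) [::] = Y (X T) [::].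
Proof.
move=> hT [r hr] [s hs]; rewrite hr hs.
under eq_bigr => x _ do rewrite hs mulr_sumr.
under [RHS]eq_bigr => x _ do rewrite hr mulr_sumr.
rewrite exchange_big /=; apply: eq_bigr => x _; apply: eq_bigr => y _.
by rewrite hT mulrCA.
Qed.
End WordOperators.

Section Restriction.
Variables (K : fieldType) (f : {rmorphism Qq -> K}) (m : nat).

Definition widen (u : braid m) : braid m.+1 :=
  [seq (x.1, widen_ord (leq_pred m) x.2) | x <- u].

Lemma widen_cat u v : widen (u ++ v) = widen u ++ widen v.
Proof. exact: map_cat. Qed.

Lemma res_subproof (phi : hspace f m.+1) : (fun u => phi (widen u)) \in @hecke_pred K f m.
Proof.
apply/asboolP; have [h1 h2 h3 h4] := hfunP phi.
split=> [u v i|u v i|u v i j ij|u v i j ij]; rewrite !widen_cat.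
- exact: h1.
- exact: h2.
- exact: h3.
- exact: h4.
Qed.
(** For a trace, restricting to the braids that leave the last strand straight
amounts to closing up this strand: [res] is the partial trace. *)
Definition res phi := HSpace (res_subproof phi).

Lemma res_is_linear : linear res.
Proof. by move=> c phi psi; apply: hfun_ext. Qed.
HB.instance Definition _ :=
  GRing.isLinear.Build K (hspace f m.+1) (hspace f m) *:%R res res_is_linear.

Lemma res_gen i phi : (i.+1 < m)%N -> res (gen i phi) = gen i (res phi).
Proof.
move=> li; have [k <-] : exists k : 'I_m.-1, k = i :> nat.
  by have li' : (i < m.-1)%N; [lia | exists (Ordinal li')].
apply: hfun_ext => u; rewrite genE /= widen_cat.
by rewrite -[nat_of_ord k]/(nat_of_ord (widen_ord (leq_pred m) k)) genE.
Qed.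

Lemma res_proj a k phi : (a + k <= m)%N ->
  res (proj f (@gen K f m.+1) a k phi) = proj f (@gen K f m) a k (res phi).
Proof. by move=> ak; apply: antisym_map => i li psi; apply: res_gen; lia. Qed.

Lemma res_projs a s phi : (a + sumn s <= m)%N ->
  res (projs f (@gen K f m.+1) a s phi) = projs f (@gen K f m) a s (res phi).
Proof.
elim: s a => [//|k s IH] a /= ak.
by rewrite res_proj ?IH //; lia.
Qed.
End Restriction.

(** A Markov trace with parameter lam, that is, the data that a skein invariant
produces on braids after the normalization by lam^- writhe. *)
Section MarkovTrace.
Variables (K : fieldType) (f : {rmorphism Qq -> K}) (lam : K).
Hypothesis lam0 : lam != 0.
Local Notation t := (f q).

(** For lam = q^n this is the quantum integer [n - i]. *)
Definition delta (i : nat) : K := (lam^-1 * t ^+ i - lam / t ^+ i) / (t^-1 - t).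

Variable tr : forall m, braid m -> K.
Hypothesis tr_hecke : forall m, hecke_functional f (tr (m := m) : braid m -> K^o).
Hypothesis tr_cyclic : forall m (u v : braid m), tr (u ++ v) = tr (v ++ u).
Hypothesis tr_empty : tr ([::] : braid 0) = 1.
Hypothesis tr_split : forall m (u : braid m), tr (widen u) = delta 0 * tr u.
Hypothesis tr_stab : forall m (u : braid m.+1),
  tr (widen u ++ [:: (true, ord_max : 'I_m.+2.-1)]) = lam^-1 * tr u.

Lemma trace_subproof m : (tr (m := m) : braid m -> K^o) \in @hecke_pred K f m.
Proof. exact/asboolP. Qed.
Definition trace m : hspace f m := HSpace (trace_subproof m).

Local Notation projsH m := (projs f (@gen K f m)).
Local Notation projH m := (proj f (@gen K f m)).
Local Notation web_opH m := (web_op f (@gen K f m)).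

Lemma res_trace m : res (trace m.+1) = delta 0 *: trace m.
Proof. by apply: hfun_ext => u; rewrite /= tr_split. Qed.

Lemma t_neq0 : t != 0.
Proof. by rewrite fmorph_eq0 q_neq0. Qed.

Lemma sqr_t_sub1_neq0 : t * t - 1 != 0.
Proof. by rewrite -rmorphM -(rmorph1 f) -rmorphB fmorph_eq0 (sqr_generic q_generic). Qed.

Lemma one_sub_sqr_t_neq0 : 1 + - t * t != 0.
Proof. by rewrite mulNr -opprB oppr_eq0 sqr_t_sub1_neq0. Qed.

(** The partial trace of a dumbbell on its last strand; this is where the
stabilization property enters. *)
Lemma res_gen_trace m : res (gen m (trace m.+2)) = delta 1 *: trace m.+1.
Proof.
apply: hfun_ext => u; suff : gen (ord_max : 'I_m.+2.-1) (trace m.+2) (widen u)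
  = delta 1 * tr u by [].
rewrite genE /= tr_split tr_stab /delta.
have := t_neq0; have := sqr_t_sub1_neq0; have := one_sub_sqr_t_neq0; move: (f q) => x x2 x1 x0.
by field; rewrite x0 lam0 x2 oner_neq0.
Qed.

Lemma qnE n : [n]_f = (t ^+ n - (t ^+ n)^-1) / (t - t^-1).
Proof.
rewrite /qn /qint -invr_expz -exprnP rmorphM fmorphV !rmorphB /=.
by rewrite fmorphV rmorphXn fmorphV.
Qed.

Lemma delta_rec k : [k.+1]_f * delta 1 - [k]_f * delta 0 = delta k.+1.
Proof.
rewrite !qnE /delta !exprS expr0 mulr1.
have := t_neq0; have := sqr_t_sub1_neq0; have := one_sub_sqr_t_neq0; move: (f q) => x x2 x1 x0.
have xk : x ^+ k != 0 by rewrite expf_neq0.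
by field; rewrite x0 lam0 xk x1 ?x2 ?oner_neq0.
Qed.

Definition circle_value (k : nat) : K := \prod_(i < k) (delta i / [i.+1]_f).

Lemma eval_res m a k s (x : hspace f m.+1) : (sumn s <= m)%N -> (a + k <= m)%N ->
  projsH m.+1 0%N s (projH m.+1 a k x) [::] = projsH m 0%N s (projH m a k (res x)) [::].
Proof. by move=> sm ak; rewrite -res_proj // -res_projs. Qed.

(** The recursion [k+1] P' = [k] P g P - [k-1] P is traced over its last strand. By
cyclicity the second P in P g P can be moved in front of the first one and
disappears, after which the last strand meets only g. The scalar obtained is
[k] delta 1 - [k-1] delta 0 = delta k. *)
Lemma trace_proj_rec m k s : sumn s = m ->
  [k.+1]_f * projsH (m + k).+1 0%N s (projH (m + k).+1 m k.+1 (trace (m + k).+1)) [::]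
  = delta k * projsH (m + k)%N 0%N s (projH (m + k)%N m k (trace (m + k)%N)) [::].
Proof.
move=> sm; have hs j : (sumn s <= m + j)%N by rewrite sm leq_addr.
case: k => [|k].
  rewrite addn0 qn1 mul1r; have := @eval_res m 0 0 s (trace m.+1).
  by rewrite /= => ->; rewrite ?sm // res_trace linearZZ.
rewrite addnS; set N := (m + k)%N.
have hN := gen_hecke f N.+2.
set T := trace N.+2; pose X := projsH N.+2 0%N s; pose P := projH N.+2 m k.+1.
have e1 : [k.+2]_f * X (projH N.+2 m k.+2 T) [::]
    = [k.+1]_f * X (P (gen N (P T))) [::] - [k]_f * X (P T) [::].
  have := congr1 (fun phi : hspace f N.+2 => phi [::])
    (proj_S f (@gen K f N.+2) m k (projsH N.+2 0%N s) T).
  by [].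
have res1 : X (P T) [::] = delta 0 * projsH N.+1 0%N s (projH N.+1 m k.+1 (trace N.+1)) [::].
  rewrite /X /P eval_res ?res_trace; [|exact: leqW (hs k)| by rewrite addnS].
  by rewrite !linearZZ.
have PP y : P (P y) = P y by rewrite /P (proj_subl hN) // addnS.
have res2 : X (P (gen N (P T))) [::]
    = delta 1 * projsH N.+1 0%N s (projH N.+1 m k.+1 (trace N.+1)) [::].
  have -> : X (P (gen N (P T))) [::] = X (P (gen N T)) [::].
    rewrite -[LHS]/((X \o (P \o @gen K f N.+2 N)) (P T) [::]).
    (* Move the rightmost P to the front, where X and the other P absorb it. *)
    rewrite word_op_cyclic; [|exact: tr_cyclic| |exact: word_op_proj].
      rewrite /= /X /P (projs_commute_r hN) ?sm //; last by rewrite addnS.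
      by rewrite -/P PP.
    apply: word_op_comp; first exact: word_op_projs.
    by apply: word_op_comp; [exact: word_op_proj | exact: word_op_gen].
  rewrite /X /P eval_res ?res_gen_trace; [|exact: leqW (hs k)| by rewrite addnS].
  by rewrite !linearZZ.
by rewrite e1 res1 res2 -(delta_rec k) mulrBl !mulrA.
Qed.

Lemma circles_value s : projsH (sumn s) 0%N s (trace (sumn s)) [::]
  = \prod_(k <- s) circle_value k.
Proof.
elim/last_ind: s => [|s k IH]; first by rewrite big_nil.
rewrite sumn_rcons -cats1 big_cat big_seq1 -IH projs_cat /=.
elim: k => [|k IHk]; first by rewrite addn0 /circle_value big_ord0 mulr1.
rewrite addnS; apply: (mulfI (qn_neq0 f k)); rewrite trace_proj_rec // IHk.
rewrite /circle_value big_ord_recr /=; move: (qn_neq0 f k).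
move: (\prod_(i < k) _) (projsH (sumn s) 0%N s (trace (sumn s)) [::]) (delta k) (qn _ _).
by move=> x y z w w0; field.
Qed.

(** The trace of the operator of the web, restricted to the image of the idempotent
of its boundary row. The width of the web is the sum of the labels of that
row. *)
Definition annular_eval (x : annular_web) : K :=
  projsH (sumn x.1) 0%N x.1 (web_opH (sumn x.1) 0%N x.2 (trace (sumn x.1))) [::].

Lemma annular_eval_rotate s t U V : is_web s U t -> is_web t V s ->
  annular_eval (s, U ++ V) = annular_eval (t, V ++ U).
Proof.
move=> /and3P[tU _ _] /and3P[tV _ _]; have st := typed_sumn tU.
rewrite /annular_eval /= st; set m := sumn t.
have hm := gen_hecke f m.
rewrite !web_op_cat (projs_web hm _ tU) ?add0n ?st //.
pose A := web_opH m 0%N U; pose B := projsH m 0%N t \o web_opH m 0%N V.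
have wB : word_op B by apply: word_op_comp; [exact: word_op_projs | exact: word_op_web].
by apply: (@word_op_cyclic K f m (trace m) A B) => //; [exact: tr_cyclic | exact: word_op_web].
Qed.

Local Notation evl := (mmap f annular_eval).

(** Linearity of [mmap] over a mere set of generators, such as annular webs, which
carry no product. *)
Lemma mmapZ_choice (I : choiceType) (h : I -> K) c (x : {malg Qq[I]}) :
  mmap f h (c *: x) = f c * mmap f h x.
Proof.
rewrite (mmapEw (msuppZ_le _ _)) mmapE mulr_sumr; apply: eq_bigr => k _.
by rewrite /= mcoeffZ rmorphM mulrA.
Qed.

(** Rotation invariance is the cyclicity of the trace; a local relation is first
surrounded by the idempotents of its level, and then vanishes as an operator. *)
Lemma annular_eval_null x : annular_null x -> evl x = 0.
Proof.
elim=> {x}[|c x y _ _ hx _ hy|s t U V wU wV|b s t r U V L R rel wU wV wr].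
- by rewrite raddf0.
- by rewrite raddfD /= mmapZ_choice hx hy mulr0 addr0.
- by rewrite raddfB /= !mmapU /= rmorph1 !mul1r (annular_eval_rotate wU wV) subrr.
have /and3P[tU _ _] := wU; have st := typed_sumn tU.
rewrite raddf_sum /=; under eq_bigr => y _ do rewrite mmapU.
rewrite /annular_eval /=; set m := sumn b.
have hm := gen_hecke f m.
pose y := web_opH m 0%N V (trace m).
transitivity (web_opH m 0%N U (\sum_(x <- r) f x.1 *: projsH m 0%N (L ++ s ++ R)
    (web_opH m 0%N (whisker L x.2 R) y)) [::]).
  rewrite raddf_sum /=.
  rewrite hfun_sum; apply: eq_bigr => x _.
  by rewrite !web_op_cat (projs_web hm _ tU) ?add0n // linearZZ.
by rewrite (web_relation_projs hm _ rel) ?raddf0 // add0n -st.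
Qed.

Lemma eval_circles c : evl (circles_annular c) = circle_eval f circle_value c.
Proof.
rewrite /circles_annular raddf_sum /=; apply: eq_bigr => s _.
by rewrite mmapU /annular_eval /= circles_value.
Qed.

Lemma dumbbell_op m (i : 'I_m.-1) x : web_opH m 0%N (dumbbell i) x = gen i x.
Proof.
rewrite /dumbbell web_op_whisker add0n /= sumn_nseq mul1n addn0.
rewrite linearZZ /= (proj_subl (gen_hecke f m)) //; last by case: i => i /=; lia.
by rewrite qbinom1 -/(qn f 2) antisym2 addn0.
Qed.

(** The bracket substitutes q^-1 - E and q - E for the crossings, which is how
crossings already act on functionals. *)
Lemma bracket_shift m (beta : braid m) phi :
  \sum_(y <- bracket beta) f y.1 *: web_opH m 0%N y.2 phi = shift beta phi.
Proof.
elim: beta => [|[b i] beta IH] /=.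
  by rewrite big_seq1 rmorph1 scale1r; apply: hfun_ext => u; rewrite /= cats0.
rewrite big_cat !big_map; move: IH; set psi := shift beta phi => IH.
transitivity (f (if b then q^-1 else q) *: psi - gen i psi).
  rewrite -{}IH; congr (_ + _).
    by rewrite scaler_sumr; apply: eq_bigr => y _; rewrite rmorphM scalerA.
  rewrite (raddf_sum (gen i)) -sumrN; apply: eq_bigr => y _.
  rewrite -[LHS]/(f (- y.1) *: web_opH m 0%N (dumbbell i ++ y.2) phi).
  rewrite web_op_cat dumbbell_op rmorphN scaleNr; congr (- _).
  exact: esym (linearZZ (gen i) _ _).
have [h1 _ _ _] := hfunP phi.
apply: hfun_ext => u; suff : f (if b then q^-1 else q) * psi u - gen i psi u
  = shift ((b, i) :: beta) phi u by [].
rewrite genE !shiftE -catA /=; have := h1 u beta i.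
case: b => [_|]; first by rewrite fmorphV; ring.
move: (phi (u ++ (true, i) :: beta)) (phi (u ++ (false, i) :: beta)) (phi (u ++ beta)) => x y z e.
have -> : y = x - (t^-1 - t) * z by rewrite -e; ring.
ring.
Qed.

Lemma eval_bracket m (beta : braid m) : evl (annular_bracket beta) = tr beta.
Proof.
rewrite /annular_bracket raddf_sum /=; under eq_bigr => y _ do rewrite mmapU.
have -> : tr beta = shift beta (trace m) [::] by [].
rewrite -bracket_shift /annular_eval /= sumn_nseq mul1n.
by rewrite hfun_sum; apply: eq_bigr => y _; rewrite projs_ones.
Qed.

(** The evaluation [annular_eval] of webs sends the bracket of a braid to its trace,
and a collection of circles to the product of their values; the difference of
the two sides of a circle expression is null. *)
Theorem trace_circle_expression m (beta : braid m) c :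
  circle_expression beta c -> tr beta = circle_eval f circle_value c.
Proof.
move=> [_ _ /annular_eval_null]; rewrite raddfB /= eval_bracket eval_circles.
by move/subr0_eq.
Qed.
End MarkovTrace.

(** * Braid closures *)
Section Tangles.
Variables (K : Type) (P : tangle -> K).
Hypothesis inv : link_invariant P.

Local Notation typedT := (typed tsrc ttgt).

Lemma typed_cat s D1 t D2 u :
  typedT s D1 t -> typedT t D2 u -> typedT s (D1 ++ D2) u.
Proof.
elim: D1 s => [|[[L g] R] D1 IH] s /=; first by move=> /eqP->.
by case/andP=> -> h1 h2; apply: IH.
Qed.

Lemma typed_whisker L R s D t :
  typedT s D t -> typedT (L ++ s ++ R) (whisker L D R) (L ++ t ++ R).
Proof.
elim: D s => [|[[L' g] R'] D IH] s /=; first by move=> /eqP->.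
case/andP=> /eqP-> /IH; rewrite -!catA => ->.
by rewrite eqxx.
Qed.

Lemma whisker_cat (A G : Type) L R (D1 D2 : diagram A G) :
  whisker L (D1 ++ D2) R = whisker L D1 R ++ whisker L D2 R.
Proof. exact: map_cat. Qed.

Lemma whisker_whisker (A G : Type) L L' R R' (D : diagram A G) :
  whisker L (whisker L' D R') R = whisker (L ++ L') D (R' ++ R).
Proof.
by rewrite /whisker -map_comp; apply: eq_map => -[[x y] z] /=; rewrite !catA.
Qed.

Lemma whisker0 (A G : Type) (D : diagram A G) : whisker [::] D [::] = D.
Proof.
by elim: D => [|[[x y] z] D IH] //=; rewrite IH cats0.
Qed.

(** Equality of two tangles from s to t under P, in every context. Stating it with
side strands L and R makes it a congruence for stacking and whiskering. *)
Definition teq s t (D1 D2 : tangle) : Prop := forall L R U V,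
  typedT [::] U (L ++ s ++ R) -> typedT (L ++ t ++ R) V [::] ->
  P (U ++ whisker L D1 R ++ V) = P (U ++ whisker L D2 R ++ V).

Lemma teq_refl s t D : teq s t D D.
Proof. by []. Qed.

Lemma teq_sym s t D1 D2 : teq s t D1 D2 -> teq s t D2 D1.
Proof. by move=> h L R U V hU hV; rewrite (h L R U V). Qed.

Lemma teq_trans D2 s t D1 D3 : teq s t D1 D2 -> teq s t D2 D3 -> teq s t D1 D3.
Proof. by move=> h k L R U V hU hV; rewrite (h L R U V) // (k L R U V). Qed.

Lemma teq_move s t D1 D2 : tangle_move s t D1 D2 -> teq s t D1 D2.
Proof. by move=> h L R U V hU hV; apply: inv h hU hV. Qed.

Lemma teq_whisker L R s t D1 D2 : teq s t D1 D2 ->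
  teq (L ++ s ++ R) (L ++ t ++ R) (whisker L D1 R) (whisker L D2 R).
Proof.
move=> h L' R' U V hU hV; rewrite !whisker_whisker.
by apply: h; rewrite -!catA in hU hV *.
Qed.

Lemma teq_catl D r s t D1 D2 : typedT r D s -> teq s t D1 D2 ->
  teq r t (D ++ D1) (D ++ D2).
Proof.
move=> hD h L R U V hU hV; rewrite !whisker_cat -!catA ![U ++ whisker _ D _ ++ _]catA.
by apply: h => //; apply: typed_cat hU _; apply: typed_whisker.
Qed.

Lemma teq_catr D s t u D1 D2 : typedT t D u -> teq s t D1 D2 ->
  teq s u (D1 ++ D) (D2 ++ D).
Proof.
move=> hD h L R U V hU hV; rewrite !whisker_cat -!catA.
by apply: h => //; apply: typed_cat hV; apply: typed_whisker.
Qed.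

Lemma teq_exchange_piece L M R g D s t : typedT s D t ->
  teq (L ++ tsrc g ++ M ++ s ++ R) (L ++ ttgt g ++ M ++ t ++ R)
    ((L, g, M ++ s ++ R) :: whisker (L ++ ttgt g ++ M) D R)
    (whisker (L ++ tsrc g ++ M) D R ++ [:: (L, g, M ++ t ++ R)]).
Proof.
elim: D s => [|[[L2 h] R2] D IH] s /=; first by move=> /eqP->.
case/andP=> /eqP-> tD; have {}IH := IH _ tD.
apply: (@teq_trans ((L ++ tsrc g ++ M ++ L2, h, R2 ++ R) ::
   (L, g, M ++ (L2 ++ ttgt h ++ R2) ++ R) :: whisker (L ++ ttgt g ++ M) D R)).
  have tW : typedT (L ++ ttgt g ++ M ++ (L2 ++ ttgt h ++ R2) ++ R)
      (whisker (L ++ ttgt g ++ M) D R) (L ++ ttgt g ++ M ++ t ++ R).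
    by have := typed_whisker (L ++ ttgt g ++ M) R tD; rewrite -!catA.
  apply: (teq_catr (D1 := [:: _; _]) (D2 := [:: _; _]) tW).
  have := @teq_whisker L (R2 ++ R) _ _ _ _ (teq_move (move_exchange (Exchange _ _ g (M ++ L2) h))).
  by rewrite /= -!catA !cats0.
have tg : typedT (L ++ tsrc g ++ M ++ (L2 ++ tsrc h ++ R2) ++ R)
    [:: (L ++ tsrc g ++ M ++ L2, h, R2 ++ R)]
    (L ++ tsrc g ++ M ++ (L2 ++ ttgt h ++ R2) ++ R).
  by rewrite /= -!catA !eqxx.
have := teq_catl tg IH.
by rewrite /= -!catA.
Qed.

(** Two diagrams with disjoint supports may slide past each other, by iterating the
exchange of two pieces. *)
Lemma teq_exchange L M R D1 D2 s1 t1 s2 t2 : typedT s1 D1 t1 -> typedT s2 D2 t2 ->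
  teq (L ++ s1 ++ M ++ s2 ++ R) (L ++ t1 ++ M ++ t2 ++ R)
    (whisker L D1 (M ++ s2 ++ R) ++ whisker (L ++ t1 ++ M) D2 R)
    (whisker (L ++ s1 ++ M) D2 R ++ whisker L D1 (M ++ t2 ++ R)).
Proof.
move=> h1 h2; elim: D1 s1 h1 => [|[[L1 g] R1] D1 IH] s1 /=.
  by move=> /eqP->; rewrite cats0; apply: teq_refl.
case/andP=> /eqP-> tD; have {}IH := IH _ tD.
apply: (@teq_trans ((L ++ L1, g, R1 ++ M ++ s2 ++ R) ::
   whisker (L ++ (L1 ++ ttgt g ++ R1) ++ M) D2 R ++ whisker L D1 (M ++ t2 ++ R))).
  apply: (teq_catl (D := [:: _]) _ IH); rewrite /= -!catA !eqxx //.
have tW := typed_whisker L (M ++ t2 ++ R) tD.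
have tW' : typedT ((L ++ L1) ++ ttgt g ++ (R1 ++ M) ++ t2 ++ R)
    (whisker L D1 (M ++ t2 ++ R)) (L ++ t1 ++ M ++ t2 ++ R) by move: tW; rewrite -!catA.
have := teq_catr tW' (@teq_exchange_piece (L ++ L1) (R1 ++ M) R g _ _ _ h2).
by rewrite /= -!catA /=.
Qed.

(** ** Cups and caps *)
Local Notation tt n := (nseq n true).
Local Notation ff n := (nseq n false).

Definition cups m : tangle := [seq (nseq i true, Cup true, nseq i false) | i <- iota 0 m].
Definition caps m : tangle :=
  [seq (nseq i true, Cap true, nseq i false) | i <- rev (iota 0 m)].

Lemma cups_S m : cups m.+1 = cups m ++ [:: (tt m, Cup true, ff m)].
Proof. by rewrite /cups -addn1 iotaD map_cat. Qed.

Lemma caps_S m : caps m.+1 = (tt m, Cap true, ff m) :: caps m.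
Proof. by rewrite /caps -addn1 iotaD rev_cat. Qed.

Lemma cups_D n r : cups (n + r) = cups n ++ whisker (tt n) (cups r) (ff n).
Proof.
elim: r => [|r IH]; first by rewrite addn0 cats0.
rewrite addnS !cups_S IH whisker_cat -catA /= !nseqD; congr (_ ++ (_ ++ [:: (_, _, _)])).
by rewrite -!nseqD addnC.
Qed.

Lemma caps_D n r : caps (n + r) = whisker (tt n) (caps r) (ff n) ++ caps n.
Proof.
elim: r => [|r IH]; first by rewrite addn0.
rewrite addnS !caps_S IH /= !nseqD; congr ((_, _, _) :: _).
by rewrite -!nseqD addnC.
Qed.

Lemma ttS m (s : seq bool) : tt m ++ true :: s = tt m.+1 ++ s.
Proof. by rewrite -addn1 nseqD -catA. Qed.

Lemma typed_cups m : typedT [::] (cups m) (tt m ++ ff m).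
Proof.
elim: m => [//|m IH]; rewrite cups_S; apply: typed_cat IH _.
by rewrite /= eqxx /= ttS eqxx.
Qed.

Lemma typed_caps m : typedT (tt m ++ ff m) (caps m) [::].
Proof.
elim: m => [//|m IH]; rewrite caps_S /= IH andbT.
by rewrite ttS eqxx.
Qed.

(** A crossing above two nested cups slides along them to the downward ends. Each
half of the way crosses one cup, and in between the two cups are exchanged so
that they lie side by side. *)
Lemma teq_cups2 o : teq [::] [:: true; true; false; false]
  (cups 2 ++ [:: ([::], Cross o true true, [:: false; false])])
  (cups 2 ++ [:: ([:: true; true], Cross o false false, [::])]).
Proof.
rewrite /cups /=.
apply: (@teq_trans [:: ([::], Cup true, [::]); ([::], Cup true, [:: true; false]);
  ([:: true], Cross (~~ o) false true, [:: false])]).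
  have := @teq_whisker [::] [:: false] _ _ _ _ (teq_move (move_cup o true true)).
  exact: (@teq_catl [:: ([::], Cup true, [::])]).
apply: (@teq_trans [:: ([::], Cup true, [::]); ([:: true; false], Cup true, [::]);
  ([:: true], Cross (~~ o) false true, [:: false])]).
  have := teq_sym (teq_move (move_exchange (Exchange tsrc ttgt (Cup true) [::] (Cup true)))).
  exact: (@teq_catr [:: ([:: true], Cross (~~ o) false true, [:: false])]).
have := @teq_whisker [:: true] [::] _ _ _ _ (teq_move (move_cup (~~ o) true false)).
rewrite /= negbK.
exact: (@teq_catl [:: ([::], Cup true, [::])]).
Qed.

Lemma teq_caps2 o : teq [:: true; true; false; false] [::]
  ([:: ([::], Cross o true true, [:: false; false])] ++ caps 2)
  ([:: ([:: true; true], Cross o false false, [::])] ++ caps 2).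
Proof.
rewrite /caps /=.
apply: (@teq_trans [:: ([:: true], Cross (~~ o) true false, [:: false]);
  ([::], Cap true, [:: true; false]); ([::], Cap true, [::])]).
  have := @teq_whisker [::] [:: false] _ _ _ _ (teq_move (move_cap o true true)).
  exact: (@teq_catr [:: ([::], Cap true, [::])]).
apply: (@teq_trans [:: ([:: true], Cross (~~ o) true false, [:: false]);
  ([:: true; false], Cap true, [::]); ([::], Cap true, [::])]).
  have := (teq_move (move_exchange (Exchange tsrc ttgt (Cap true) [::] (Cap true)))).
  exact: (@teq_catl [:: ([:: true], Cross (~~ o) true false, [:: false])]).
have := @teq_whisker [:: true] [::] _ _ _ _ (teq_move (move_cap (~~ o) true false)).
rewrite /= negbK.
exact: (@teq_catr [:: ([::], Cap true, [::])]).
Qed.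
End Tangles.

Section Closures.
Variables (K : Type) (P : tangle -> K).
Hypothesis inv : link_invariant P.

Local Notation typedT := (typed tsrc ttgt).
Local Notation tt n := (nseq n true).
Local Notation ff n := (nseq n false).
Local Notation teq := (teq P).

Definition up_crossing m (o : bool) i : tangle := [:: (tt i, Cross o true true, tt (m - i.+2))].
(** The crossing of the downward closing arcs i and i+1, which are nested: arc 0 is
the rightmost one. *)
Definition down_crossing m (o : bool) i : tangle :=
  [:: (ff (m - i.+2), Cross o false false, ff i)].

Lemma tt_split m i : (i.+1 < m)%N -> tt i ++ [:: true, true & tt (m - i.+2)] = tt m.
Proof.
move=> h; rewrite -[[:: _, _ & _]]/(nseq (2 + (m - i.+2)) true) -nseqD.
by congr nseq; lia.
Qed.

Lemma ff_split m i : (i.+1 < m)%N -> ff (m - i.+2) ++ [:: false, false & ff i] = ff m.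
Proof.
move=> h; rewrite -[[:: _, _ & _]]/(nseq (2 + i) false) -nseqD.
by congr nseq; lia.
Qed.

Lemma typed_down m o i : (i.+1 < m)%N -> typedT (ff m) (down_crossing m o i) (ff m).
Proof. by move=> h; rewrite /= ff_split // eqxx. Qed.

(** The cups inside the arcs i and i+1 are distant from the crossing and slide off,
which reduces the claim to the two nested cups [teq_cups2]. *)
Lemma teq_cups_slide m o i : (i.+1 < m)%N -> teq [::] (tt m ++ ff m)
  (cups m ++ whisker [::] (up_crossing m o i) (ff m))
  (cups m ++ whisker (tt m) (down_crossing m o i) [::]).
Proof.
move=> h; have [r mE] : exists r, m = (i + (2 + r))%N by exists (m - i.+2)%N; lia.
have fr : ff r ++ [:: false; false] = [:: false, false & ff r].
  by rewrite -[[:: false; false]]/(ff 2) -nseqD addnC.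
have base : teq [::] [:: true, true & tt r ++ [:: false, false & ff r]]
  (cups (2 + r) ++ [:: ([::], Cross o true true, tt r ++ [:: false, false & ff r])])
  (cups (2 + r) ++ [:: ([:: true, true & tt r ++ ff r], Cross o false false, [::])]).
  rewrite cups_D -!catA.
  have e1 := @teq_exchange _ _ inv [::] [::] [:: false; false]
    [:: ([::], Cross o true true, [::])]
    (cups r) [:: true; true] [:: true; true] _ _ isT (typed_cups r).
  have e2 := @teq_exchange _ _ inv [:: true; true] [::] [::] (cups r)
    [:: ([::], Cross o false false, [::])] _ _
    [:: false; false] [:: false; false] (typed_cups r) isT.
  rewrite /= -?catA /= ?fr ?cats0 in e1 e2.
  apply: teq_trans (teq_catl (typed_cups 2) (teq_sym e1)) _.
  apply: teq_trans _ (teq_catl (typed_cups 2) (teq_sym e2)).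
  apply: (teq_catr (D1 := cups 2 ++ [:: _]) (D2 := cups 2 ++ [:: _]) _ (teq_cups2 inv o)).
  have := typed_whisker [:: true; true] [:: false; false] (typed_cups r).
  by rewrite /= -catA fr.
have mi : (m - i.+2 = r)%N by lia.
have tm : tt m = tt i ++ [:: true, true & tt r] by rewrite mE nseqD.
have fm : ff m = [:: false, false & ff r ++ ff i] by rewrite mE addnC nseqD.
have cm : cups m = cups i ++ whisker (tt i) (cups (2 + r)) (ff i) by rewrite mE cups_D.
have := teq_catl (typed_cups i) (@teq_whisker _ _ (tt i) (ff i) _ _ _ _ base).
by rewrite !whisker_cat /up_crossing /down_crossing mi cm tm fm /= -?catA /= ?cats0 -?catA.
Qed.

Lemma teq_caps_slide m o i : (i.+1 < m)%N -> teq (tt m ++ ff m) [::]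
  (whisker [::] (up_crossing m o i) (ff m) ++ caps m)
  (whisker (tt m) (down_crossing m o i) [::] ++ caps m).
Proof.
move=> h; have [r mE] : exists r, m = (i + (2 + r))%N by exists (m - i.+2)%N; lia.
have fr : ff r ++ [:: false; false] = [:: false, false & ff r].
  by rewrite -[[:: false; false]]/(ff 2) -nseqD addnC.
have base : teq [:: true, true & tt r ++ [:: false, false & ff r]] [::]
  ([:: ([::], Cross o true true, tt r ++ [:: false, false & ff r])] ++ caps (2 + r))
  ([:: ([:: true, true & tt r ++ ff r], Cross o false false, [::])] ++ caps (2 + r)).
  rewrite caps_D.
  have e1 := @teq_exchange _ _ inv [::] [::] [:: false; false]
    [:: ([::], Cross o true true, [::])]
    (caps r) [:: true; true] [:: true; true] _ _ isT (typed_caps r).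
  have e2 := @teq_exchange _ _ inv [:: true; true] [::] [::] (caps r)
    [:: ([::], Cross o false false, [::])] _ _
    [:: false; false] [:: false; false] (typed_caps r) isT.
  rewrite /= -?catA /= ?fr ?cats0 in e1 e2.
  apply: teq_trans (teq_catr (typed_caps 2) e1) _.
  apply: teq_trans _ (teq_catr (typed_caps 2) e2).
  rewrite -!catA; apply: (teq_catl (D1 := _ :: caps 2) (D2 := _ :: caps 2) _ (teq_caps2 inv o)).
  have := typed_whisker [:: true; true] [:: false; false] (typed_caps r).
  by rewrite /= -catA fr.
have mi : (m - i.+2 = r)%N by lia.
have tm : tt m = tt i ++ [:: true, true & tt r] by rewrite mE nseqD.
have fm : ff m = [:: false, false & ff r ++ ff i] by rewrite mE addnC nseqD.
have cm : caps m = whisker (tt i) (caps (2 + r)) (ff i) ++ caps i by rewrite mE caps_D.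
have := teq_catr (typed_caps i) (@teq_whisker _ _ (tt i) (ff i) _ _ _ _ base).
by rewrite !whisker_cat /up_crossing /down_crossing mi cm tm fm /= -?catA /= ?cats0 -?catA.
Qed.

Definition up_braid m (u : braid m) : tangle :=
  [seq (tt (x.2 : 'I_m.-1), Cross x.1 true true, tt (m - (x.2 : nat).+2)) | x <- u].

Lemma ord_ltS m (i : 'I_m.-1) : (i.+1 < m)%N.
Proof. by case: i => i /=; lia. Qed.

Lemma typed_up_braid m u : typedT (tt m) (@up_braid m u) (tt m).
Proof.
elim: u => [|[o i] u IH] /=; first exact: eqxx.
by rewrite tt_split ?ord_ltS // eqxx.
Qed.

Lemma braid_closureE m (u : braid m) :
  braid_closure u = cups m ++ whisker [::] (up_braid u) (ff m) ++ caps m.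
Proof. by rewrite /braid_closure /whisker /up_braid -map_comp. Qed.

Lemma teq_closed s D1 D2 : teq s s D1 D2 -> s = [::] -> P D1 = P D2.
Proof.
by move=> h s0; have := h [::] [::] [::] [::]; rewrite s0 !whisker0 !cats0; apply.
Qed.

(** The last crossing of the braid slides over the caps to the closing arcs, down
along them past the whole braid, and through the cups to the bottom. *)
Lemma closure_rotate m (x : bool * 'I_m.-1) (u : braid m) :
  P (braid_closure (u ++ [:: x])) = P (braid_closure (x :: u)).
Proof.
case: x => o i; have him := ord_ltS i.
apply: (@teq_closed [::] _ _ _ erefl); rewrite !braid_closureE.
rewrite -[(o, i) :: u]cat1s /up_braid !map_cat -!/(up_braid _) !whisker_cat -!catA.
rewrite -[up_braid [:: (o, i)]]/(up_crossing m o i).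
have tu := typed_whisker [::] (ff m) (typed_up_braid u).
have td := typed_whisker (tt m) [::] (@typed_down m o i him).
rewrite !cats0 in td.
apply: teq_trans (teq_catl (typed_cups m) (teq_catl tu (@teq_caps_slide m o i him))) _.
apply: (@teq_trans _ _ (cups m ++ whisker (tt m) (down_crossing m o i) [::] ++
   whisker [::] (up_braid u) (ff m) ++ caps m)).
  apply: (teq_catl (typed_cups m)); rewrite !catA; apply: (teq_catr (typed_caps m)).
  have := @teq_exchange _ _ inv [::] [::] [::] _ _ _ _ _ _
    (typed_up_braid u) (@typed_down m o i him).
  by rewrite /= !cats0.
rewrite !catA; apply: (teq_catr (typed_caps m)); apply: (@teq_catr _ _ _ _ (tt m ++ ff m)).
  exact: tu.
exact: teq_sym (@teq_cups_slide m o i him).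
Qed.

Lemma closure_cyclic m (u v : braid m) :
  P (braid_closure (u ++ v)) = P (braid_closure (v ++ u)).
Proof.
elim: v u => [|x v IH] u; first by rewrite cats0.
by rewrite -cat1s catA IH catA closure_rotate.
Qed.

Lemma closure_local m (w1 w2 u v : braid m) :
  teq (tt m) (tt m) (up_braid w1) (up_braid w2) ->
  P (braid_closure (u ++ w1 ++ v)) = P (braid_closure (u ++ w2 ++ v)).
Proof.
move=> h; apply: (@teq_closed [::] _ _ _ erefl); rewrite !braid_closureE.
rewrite /up_braid !map_cat -!/(up_braid _) !whisker_cat -!catA.
apply: (teq_catl (typed_cups m)).
apply: (teq_catl (typed_whisker [::] (ff m) (typed_up_braid u))).
apply: (@teq_catr _ _ _ _ (tt m ++ ff m)).
  apply: typed_cat (typed_caps m); exact: (typed_whisker [::] (ff m) (typed_up_braid v)).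
exact: (@teq_whisker _ _ [::] (ff m) _ _ _ _ h).
Qed.
End Closures.

(** * The Markov trace of a skein invariant *)
Section InvariantTrace.
Variables (K : fieldType) (f : {rmorphism Qq -> K}) (lam : K) (P : tangle -> K).
Hypothesis lam0 : lam != 0.
Hypothesis inv : link_invariant P.
Local Notation t := (f q).
Hypothesis skein : skein_relation lam (t^-1 - t) P.
Hypothesis P_unknot : P unknot = delta f lam 0.
Local Notation tt n := (nseq n true).
Local Notation ff n := (nseq n false).

(** The value 1 on the empty braid is a convention: no Reidemeister or skein move
relates the empty link to another one, so P says nothing about it, while the
empty collection of circles has value 1. *)
Definition inv_trace m (u : braid m) : K :=
  if m == 0%N then 1 else lam ^ (- writhe u) * P (braid_closure u).

Lemma writhe_cat m (u v : braid m) : writhe (u ++ v) = writhe u + writhe v.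
Proof. by rewrite /writhe big_cat. Qed.

Lemma writhe_cons m x (u : braid m) : writhe (x :: u) = (if x.1 then 1 else -1) + writhe u.
Proof. by rewrite /writhe big_cons. Qed.

Lemma writhe_widen m (u : braid m) : writhe (widen u) = writhe u.
Proof. by rewrite /writhe big_map. Qed.

Lemma closure_skein m (u v : braid m) i :
  lam^-1 * P (braid_closure (u ++ (true, i) :: v))
  - lam * P (braid_closure (u ++ (false, i) :: v))
  = (t^-1 - t) * P (braid_closure (u ++ v)).
Proof.
have split w : braid_closure (u ++ w ++ v)
    = (cups m ++ whisker [::] (up_braid u) (ff m)) ++ whisker [::] (up_braid w) (ff m)
      ++ (whisker [::] (up_braid v) (ff m) ++ caps m).
  by rewrite braid_closureE /up_braid !map_cat -!/(up_braid _) !whisker_cat -!catA.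
rewrite -[(true, i) :: v]cat1s -[(false, i) :: v]cat1s -[u ++ v]/(u ++ [::] ++ v) !split /=.
apply: skein; rewrite /is_link.
have tw x := typed_whisker [::] (ff m) (typed_up_braid (m := m) x).
apply: typed_cat (typed_cat (typed_cups m) (tw u)) _.
apply: typed_cat (tw [:: (true, i)]) _.
exact: typed_cat (tw v) (typed_caps m).
Qed.

Lemma inv_trace_hecke m :
  hecke_functional f (inv_trace (m := m) : braid m -> K^o).
Proof.
case: m => [|m]; first by split=> [u v []|u v []|u v []|u v []].
rewrite /inv_trace /=; split=> [u v i|u v i|u v i j ij|u v i j ij].
- have := closure_skein u v i; rewrite !writhe_cat !writhe_cons !opprD !(expfzDr _ _ lam0).
  rewrite /= opprK exprN1 expr1z => e.
  rewrite [RHS]mulrCA -e; ring.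
- rewrite !writhe_cat !writhe_cons /= [1 + _]addrA subrr add0r; congr (_ * _).
  apply: (@closure_local _ P m.+1 [:: (true, i); (false, i)] [::]).
  have := @teq_whisker _ P (tt i) (tt (m.+1 - i.+2)) _ _ _ _
    (teq_move inv (move_R2 true true true)).
  by have hi := @ord_ltS m.+1 i; rewrite /= !cats0 tt_split.
- rewrite !writhe_cat !writhe_cons /=; congr (_ * _).
  apply: (@closure_local _ P m.+1 [:: (true, i); (true, j); (true, i)]
    [:: (true, j); (true, i); (true, j)]).
  have := @teq_whisker _ P (tt i) (tt (m.+1 - i.+3)) _ _ _ _
    (teq_move inv (@move_R3 true true true true true true isT)).
  have hj := @ord_ltS m.+1 j; have hi := @ord_ltS m.+1 i; rewrite ij in hj.
  have ti : tt i ++ [:: true] = tt i.+1 by rewrite ttS cats0.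
  have tm : tt (m.+1 - i.+2) = true :: tt (m.+1 - i.+3).
    by have -> : (m.+1 - i.+2 = (m.+1 - i.+3).+1)%N by lia.
  by rewrite /= !ti !cats0 ij -tm tt_split.
- rewrite !writhe_cat !writhe_cons /=; congr (_ * _).
  apply: (@closure_local _ P m.+1 [:: (true, i); (true, j)] [:: (true, j); (true, i)]).
  have := @teq_whisker _ P (tt i) (tt (m.+1 - j.+2)) _ _ _ _ (teq_move inv
    (move_exchange (Exchange tsrc ttgt (Cross true true true) (tt (j - i.+2))
      (Cross true true true)))).
  have hj := @ord_ltS m.+1 j; have hi := @ord_ltS m.+1 i.
  have tj : tt i ++ [:: true, true & tt (j - i.+2)] = tt j by rewrite tt_split.
  have tm : tt (j - i.+2) ++ [:: true, true & tt (m.+1 - j.+2)] = tt (m.+1 - i.+2).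
    by rewrite -[[:: _, _ & _]]/(nseq (2 + (m.+1 - j.+2)) true) -nseqD; congr nseq; lia.
  by rewrite /= -!catA /= !tm !tj !cats0 tt_split.
Qed.

Lemma inv_trace_cyclic m (u v : braid m) : inv_trace (u ++ v) = inv_trace (v ++ u).
Proof.
by rewrite /inv_trace !writhe_cat addrC (closure_cyclic inv).
Qed.

Lemma up_widen m (u : braid m) :
  whisker [::] (up_braid (widen u)) (ff m.+1)
  = whisker [::] (up_braid u) ([:: true; false] ++ ff m).
Proof.
rewrite /up_braid /widen /whisker -!map_comp; apply: eq_map => -[o i] /=.
have hi := ord_ltS i; congr (_, _, _).
by have -> : (m.+1 - i.+2 = (m - i.+2).+1)%N; [lia | rewrite -ttS].
Qed.

(** The innermost closing arc of the last strand can be shrunk past the part of the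
braid that avoids this strand. *)
Lemma closure_widen m (u w : braid m.+1) (u' : braid m) : u = widen u' ->
  P (braid_closure (u ++ w))
  = P (cups m ++ whisker [::] (up_braid u') (ff m) ++ (tt m, Cup true, ff m)
     :: whisker [::] (up_braid w) (ff m.+1) ++ (tt m, Cap true, ff m) :: caps m).
Proof.
move=> ->; apply: (@teq_closed _ P [::] _ _ _ erefl); rewrite !braid_closureE.
rewrite /up_braid map_cat -!/(up_braid _) whisker_cat up_widen cups_S caps_S -!catA.
apply: (teq_catl (typed_cups m)).
have e1 := @teq_exchange _ _ inv [::] [::] (ff m) _ [:: ([::], Cup true, [::])]
  _ _ [::] [:: true; false] (typed_up_braid u') isT.
rewrite /= !cats0 in e1.
have tw : typed tsrc ttgt (tt m ++ [:: true, false & ff m])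
    (whisker [::] (up_braid w) (ff m.+1) ++ (tt m, Cap true, ff m) :: caps m) [::].
  apply: (@typed_cat _ _ (tt m ++ [:: true, false & ff m])).
    rewrite -[_ ++ _]/(tt m ++ true :: ff m.+1) ttS.
    exact: (typed_whisker [::] (ff m.+1) (typed_up_braid w)).
  by rewrite /= eqxx typed_caps.
have := teq_catr tw (teq_sym e1).
by rewrite /= -!catA.
Qed.

(** Once the arc is shrunk next to the crossing, the kink is removed by the first
Reidemeister move. *)
Lemma closure_stab m (u : braid m.+1) o :
  P (braid_closure (widen u ++ [:: (o, ord_max : 'I_m.+2.-1)])) = P (braid_closure u).
Proof.
rewrite (closure_widen _ erefl) braid_closureE.
have tt1 : tt m ++ [:: true] = tt m.+1 by rewrite ttS cats0.
have h := @teq_whisker _ P (tt m) (ff m.+1) _ _ _ _ (teq_move inv (move_R1 o true)).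
rewrite catA tt1 /= tt1 cats0 in h.
have tu : typed tsrc ttgt (tt m.+1 ++ ff m.+1)
  (whisker [::] (up_braid u) (ff m.+1)) (tt m.+1 ++ ff m.+1).
  exact: (typed_whisker [::] (ff m.+1) (typed_up_braid u)).
have hc := teq_catl (typed_cups m.+1) (teq_catl tu (teq_catr (typed_caps m.+1) h)).
rewrite [up_braid [:: _]]/up_braid /= subnn.
exact: (teq_closed hc erefl).
Qed.

Lemma inv_trace_stab m (u : braid m.+1) :
  inv_trace (widen u ++ [:: (true, ord_max : 'I_m.+2.-1)]) = lam^-1 * inv_trace u.
Proof.
rewrite /inv_trace /= closure_stab writhe_cat writhe_widen.
have -> : writhe ([:: (true, ord_max)] : braid m.+2) = 1 by rewrite /writhe big_seq1.
by rewrite addrC opprD expfzDr // exprN1 mulrA.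
Qed.

Lemma t_sub_neq0 : t^-1 - t != 0.
Proof.
rewrite -fmorphV -rmorphB fmorph_eq0 -opprB oppr_eq0 -[q]expr1.
exact: (subV_generic q_generic q_neq0 0).
Qed.

(** A skein triple at a kink: both crossings can be removed, which determines the
value of the link with an additional split unknot. For m = 0 there is no
crossing available, and the claim is the value of the unknot. *)
Lemma inv_trace_split m (u : braid m) :
  inv_trace (widen u) = delta f lam 0 * inv_trace u.
Proof.
case: m u => [|m] u.
  have -> : u = [::] by case: u => // -[o []].
  rewrite /inv_trace /= /writhe big_nil oppr0 expr0z mul1r mulr1.
  exact: P_unknot.
rewrite /inv_trace /= writhe_widen [RHS]mulrCA; congr (_ * _).
have := closure_skein (widen u) [::] (ord_max : 'I_m.+2.-1).
rewrite !closure_stab cats0 => e; apply: (mulfI t_sub_neq0); rewrite -e.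
rewrite /delta expr0 mulr1 divr1 mulrA [_ * (_ / _)]mulrC divfK ?t_sub_neq0 //.
by rewrite mulrBl.
Qed.

Theorem invariant_circle_expression m (beta : braid m) c : (0 < m)%N ->
  circle_expression beta c ->
  P (braid_closure beta) = lam ^ writhe beta * circle_eval f (circle_value f lam) c.
Proof.
move=> m0 hc.
have <- := trace_circle_expression lam0 inv_trace_hecke inv_trace_cyclic erefl
  inv_trace_split inv_trace_stab hc.
rewrite /inv_trace; case: m m0 beta {c hc} => // m _ beta /=.
by rewrite mulrA -expfzDr // subrr expr0z mul1r.
Qed.
End InvariantTrace.

(** * Laurent polynomiality *)

Lemma laurentM x y : laurent x -> laurent y -> laurent (x * y).
Proof.
move=> [p [n ->]] [r [k ->]]; exists (p * r), (n + k)%N.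
by rewrite tofracM exprD invfM mulrACA.
Qed.

Lemma laurentD x y : laurent x -> laurent y -> laurent (x + y).
Proof.
move=> [p [n ->]] [r [k ->]]; exists (p * 'X^k + r * 'X^n), (n + k)%N.
by rewrite addf_div ?expf_neq0 ?q_neq0 // tofracD !tofracM !tofracXn exprD.
Qed.

Lemma laurent0 : laurent 0.
Proof. by exists 0, 0%N; rewrite tofrac0 mul0r. Qed.

Lemma laurent1 : laurent 1.
Proof. by exists 1, 0%N; rewrite tofrac1 expr0 divr1. Qed.

Lemma laurent_expz (z : int) : laurent (q ^ z).
Proof.
case: z => n; first by exists ('X^n), 0%N; rewrite tofracXn expr0 divr1.
by exists 1, n.+1; rewrite tofrac1 mul1r.
Qed.

Lemma qbinomSS n k : qbinom n.+1 k.+1 = qint n.+1%:Z / qint k.+1%:Z * qbinom n k.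
Proof.
have shift_num (F : fieldType) (g g' h : nat -> F) : (forall i, g i.+1 = g' i) ->
    \prod_(i < k.+1) (g i / h i.+1) = g 0%N / h k.+1 * \prod_(i < k) (g' i / h i.+1).
  move=> gg'; rewrite !prodf_div mulf_div big_ord_recl [X in _ / X]big_ord_recr.
  by rewrite [X in _ / X]mulrC; congr (_ * _ / _); apply: eq_bigr => i _; rewrite -gg'.
have := @shift_num _ (fun i => qint (n.+1%:Z - i%:Z)) (fun i => qint (n%:Z - i%:Z))
  (fun i => qint i%:Z).
by rewrite subr0; apply=> i; congr qint; lia.
Qed.

Lemma qbinomS n k : qbinom n k.+1 = qbinom n k * (qint (n%:Z - k%:Z) / qint k.+1%:Z).
Proof. by rewrite /qbinom big_ord_recr. Qed.

Lemma qbinom_pascal n k : qbinom n.+1 k.+1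
  = q ^ k.+1%:Z * qbinom n k.+1 + q ^ (- (n%:Z - k%:Z)) * qbinom n k.
Proof.
have nk : n.+1%:Z = (n%:Z - k%:Z) + k.+1%:Z by lia.
have e : qint n.+1%:Z = q ^ k.+1%:Z * qint (n%:Z - k%:Z) + q ^ (- (n%:Z - k%:Z)) * qint k.+1%:Z.
  by rewrite nk; apply: (qnum_add q_generic q_neq0).
rewrite qbinomSS qbinomS e; have := qint_neq0 k.
move: (qint k.+1%:Z) (qint (n%:Z - k%:Z)) (qbinom n k) (q ^ k.+1%:Z) (q ^ _) => x y z u v x0.
by rewrite mulrDl mulfK // mulrDl -!mulrA [z * _]mulrC -!mulrA.
Qed.

Lemma laurent_qbinom n k : laurent (qbinom n k).
Proof.
elim: n k => [|n IH] [|k]; try by rewrite /qbinom big_ord0; apply: laurent1.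
  rewrite /qbinom big_ord_recl subr0 (_ : qint 0 = 0); last exact: qnum0.
  by rewrite !mul0r; apply: laurent0.
rewrite qbinom_pascal; apply: laurentD; apply: laurentM (IH _); exact: laurent_expz.
Qed.

Lemma laurent_circle_eval n c : (forall s, laurent c@_s) ->
  laurent (circle_eval id (qbinom n) c).
Proof.
move=> hc; rewrite /circle_eval; apply: (big_ind laurent laurent0 laurentD) => s _.
apply: laurentM (hc s) _; apply: (big_ind laurent laurent1 laurentM) => k _.
exact: laurent_qbinom.
Qed.

(** * Values of the circles *)

(** The embedding [inQqa], presented as a composition of ring morphisms so that it
is one itself. *)
Definition emb_Qqa : {rmorphism Qq -> Qqa} := (@FracField.tofrac {poly Qq} \o polyC).

Section Values.
Variables (F : fieldType) (x : F).
Hypothesis x0 : x != 0.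
Hypothesis x1 : x * x - 1 != 0.

Lemma sln_factor (n i : nat) :
  ((x ^+ n)^-1 * x ^+ i - x ^+ n / x ^+ i) / (x^-1 - x) = qnum x (n%:Z - i%:Z).
Proof.
rewrite /qnum opprB !expfzDr // -!invr_expz -!exprnP.
have := expf_neq0 n x0; have := expf_neq0 i x0.
move: (x ^+ n) (x ^+ i) => u v v0 u0.
have x2 : 1 + - x * x != 0 by rewrite mulNr -opprB oppr_eq0.
by field; rewrite x0 v0 u0 x1 x2 ?oner_neq0.
Qed.

(** The ratio of consecutive circle values; (k+1)^2 - k^2 = 2k + 1 explains the
power of x. *)
Lemma homfly_factor (a : F) k : a != 0 -> 1 - x ^+ (2 * k.+1) != 0 ->
  (a^-1 * x ^+ k - a / x ^+ k) / (x^-1 - x) / qnum x k.+1%:Z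
  = x ^+ (2 * k + 1) * a^-1 *
     ((1 - a ^+ 2 * x ^ (2%:Z - (2 * k.+1)%N%:Z)) / (1 - x ^+ (2 * k.+1))).
Proof.
move=> a0.
have -> : 2%:Z - (2 * k.+1)%N%:Z = - (2 * k)%N%:Z by lia.
rewrite -invr_expz -exprnP /qnum -invr_expz -exprnP exprS.
have -> : x ^+ (2 * k.+1) = x * x * (x ^+ k * x ^+ k).
  by rewrite -!exprD -expr2 -exprD; congr (_ ^+ _); lia.
have -> : x ^+ (2 * k + 1) = x * (x ^+ k * x ^+ k).
  by rewrite -exprD -exprS; congr (_ ^+ _); lia.
have -> : x ^+ (2 * k) = x ^+ k * x ^+ k.
  by rewrite -exprD; congr (_ ^+ _); lia.
have := expf_neq0 k x0; move: (x ^+ k) => u u0 h.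
have x2 : 1 + - x * x != 0 by rewrite mulNr -opprB oppr_eq0.
have h' : x * u * (x * u) - 1 != 0 by rewrite mulrACA -opprB oppr_eq0.
by field; rewrite h u0 a0 x0 x1 h' x2.
Qed.

Lemma homfly_prod (a : F) k : a != 0 -> (forall j, 1 - x ^+ (2 * j.+1) != 0) ->
  \prod_(i < k) ((a^-1 * x ^+ i - a / x ^+ i) / (x^-1 - x) / qnum x i.+1%:Z)
  = x ^+ (k ^ 2)%N * a ^- k * \prod_(1 <= i < k.+1)
     ((1 - a ^+ 2 * x ^ (2%:Z - (2 * i)%N%:Z)) / (1 - x ^+ (2 * i)%N)).
Proof.
move=> a0 xk; rewrite big_add1 big_mkord /=.
elim: k => [|k IH]; first by rewrite !big_ord0 !expr0 invr1 !mulr1.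
rewrite !big_ord_recr /= {}IH (homfly_factor a0 (xk k)).
have -> : (k.+1 ^ 2 = k ^ 2 + (2 * k + 1))%N by lia.
rewrite [x ^+ (k ^ 2 + _)]exprD [a ^+ k.+1]exprSr [(a ^+ k * a)^-1]invfM.
move: (\prod_(i < k) _) (_ / (1 - _)) (a ^- k) a^-1 (x ^+ (k ^ 2)) (x ^+ (2 * k + 1)).
move=> A B C D E G.
ring.
Qed.
End Values.

Lemma circle_value_sln n k : circle_value idfun (q ^+ n) k = qbinom n k.
Proof.
apply: eq_bigr => i _; congr (_ / _).
exact: (sln_factor q_neq0 (sqr_generic q_generic)).
Qed.

Lemma a_neq0 : a != 0.
Proof. by rewrite /a tofrac_eq0 polyX_eq0. Qed.

Lemma emb_Qqa_qint n : emb_Qqa (qint n%:Z) = qnum (emb_Qqa q) n%:Z.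
Proof. by rewrite -/(qn emb_Qqa n) qnE /qnum -invr_expz. Qed.

Lemma circle_value_homfly k : circle_value emb_Qqa a k = circle_infty k.
Proof.
have x0 : emb_Qqa q != 0 by rewrite fmorph_eq0 q_neq0.
have x1 : emb_Qqa q * emb_Qqa q - 1 != 0.
  by rewrite -rmorphM -(rmorph1 emb_Qqa) -rmorphB fmorph_eq0 (sqr_generic q_generic).
have xk j : 1 - emb_Qqa q ^+ (2 * j.+1) != 0.
  rewrite -rmorphXn -(rmorph1 emb_Qqa) -rmorphB fmorph_eq0 subr_eq0 eq_sym.
  by rewrite mulnS addSn q_generic.
rewrite -[circle_infty k]/(_ * _ * _) -[inQqa q]/(emb_Qqa q).
rewrite -(homfly_prod x0 x1 k a_neq0 xk); apply: eq_bigr => i _.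
by rewrite /delta /qn emb_Qqa_qint.
Qed.

(** * The link polynomials *)

Theorem proposition1p3 (m : nat) (hm : (0 < m)%N) (beta : braid m)
    (c : {malg Qq[seq nat]}) (hc : circle_expression beta c) :
  (forall n : nat, (1 <= n)%N ->
     laurent (circle_eval id (qbinom n) c) /\
     forall Pn : tangle -> Qq, is_sln_polynomial n Pn ->
       Pn (braid_closure beta) =
         q ^ (n%:Z * writhe beta) * circle_eval id (qbinom n) c) /\
  (forall Pinf : tangle -> Qqa, is_HOMFLYPT Pinf ->
     Pinf (braid_closure beta) =
       a ^ (writhe beta) * circle_eval inQqa circle_infty c).
Proof.
have eq_eval (K : fieldType) (g : Qq -> K) v w : v =1 w -> circle_eval g v c = circle_eval g w c.
  by move=> vw; apply: eq_bigr => s _; congr (_ * _); apply: eq_bigr => k _.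
split=> [n _|P [inv skein unknotP]].
  split; first by case: hc => hl _ _; apply: laurent_circle_eval.
  move=> P [inv skein unknotP].
  have lam0 : q ^+ n != 0 by rewrite expf_neq0 ?q_neq0.
  rewrite -exprz_exp -exprnP.
  have := @invariant_circle_expression _ idfun _ P lam0 inv skein _ m beta c hm hc.
  rewrite (eq_eval _ _ _ _ (circle_value_sln n)); apply.
  rewrite unknotP -[n%:Z]subr0; symmetry.
  exact: (sln_factor q_neq0 (sqr_generic q_generic) n 0).
have z : inQqa q^-1 = (emb_Qqa q)^-1 by rewrite -fmorphV.
rewrite z in skein unknotP.
have := @invariant_circle_expression _ emb_Qqa _ P a_neq0 inv skein _ m beta c hm hc.
rewrite (eq_eval _ _ _ _ circle_value_homfly); apply.
have negneg (F : fieldType) (u v w y : F) : (u - v) / (w - y) = (v - u) / (y - w).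
  by rewrite -opprB -(opprB y) invrN mulrNN.
by rewrite unknotP /delta expr0 divr1 mulr1 -[inQqa q]/(emb_Qqa q) negneg.
Qed.
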